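(* Consider the infinite server system under the work conserving scheduling policy that assigns every generated packet to a new server (the G/G/$\infty$ queue), with inter-generation time distribution $F_X$ ($\mathbb{E}[X]=1/\lambda$) fixed, service rate $\mu$, and $\lambda<\mu$. Let $A_{\min}$ be the infimum of the average age $A^{\mathrm{ave}}_{\mathrm{G/G/}\infty}(F_S)$ over all service time distributions $F_S$ with $\mathbb{E}[S]=1/\mu$, and let $V(a)$ be the infimum of the packet delay variance $\mathrm{VarD}(F_S)$ over all $F_S$ with $A^{\mathrm{ave}}_{\mathrm{G/G/}\infty}(F_S)\le a$ and $\mathbb{E}[S]=1/\mu$. Then there is a strong age-delay variance tradeoff: $V(a)\to+\infty$ as $a$ approaches $A_{\min}$.
   Context: Update packets $i=1,2,\dots$ are generated at times $t_1<t_2<\cdots$ of a renewal process with i.i.d. inter-generation times distributed as $X\sim F_X$. Each generated packet is immediately put into service at its own new server; service times $S_i$ are i.i.d. with distribution $F_S$, independent of the generation process, so packet $i$ reaches the destination at time $t_i'=t_i+S_i$ and its delay $D_i=t_i'-t_i$ equals $S_i$; $\mathrm{VarD}(F_S)$ is the variance of the packet delay. With $\mathcal{P}(t)$ the set of packets received up to time $t$, the age is $A(t)=\min_{i\in\mathcal{P}(t)}(t-t_i)$ and the average age is $A^{\mathrm{ave}}=\limsup_{T\to\infty}\mathbb{E}\left[\frac1T\int_0^TA(t)\,dt\right]$, denoted $A^{\mathrm{ave}}_{\mathrm{G/G/}\infty}(F_S)$ for this queue. *)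

(* Defs.v *)
From HB Require Import structures.
From mathcomp Require Import all_boot all_order all_algebra.
From mathcomp Require Import all_classical all_reals all_analysis.

Set Implicit Arguments.
Unset Strict Implicit.
Unset Printing Implicit Defensive.

Import Order.TTheory GRing.Theory Num.Theory.
Import numFieldNormedType.Exports.

Local Open Scope classical_set_scope.
Local Open Scope ring_scope.
Local Open Scope ereal_scope.

Definition mutually_independent d (T : measurableType d) (R : realType)
    (P : probability T R) (I : choiceType) (Y : I -> {RV P >-> R}) : Prop :=
  forall (J : seq I) (B : I -> set R), uniq J ->
    (forall j, measurable (B j)) ->
    P (\bigcap_(j in [set` J]) (Y j @^-1` B j)) =
    \prod_(j <- J) P (Y j @^-1` B j).

Definition has_distribution d (T : measurableType d) (R : realType)
    (P : probability T R) (Y : {RV P >-> R})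
    (F : probability (measurableTypeR R) R) : Prop :=
  forall B : set R, measurable B -> distribution P Y B = F B.

(* The data of a G/G/infinity queue.  Packets are numbered from 0.  Joint
   mutual independence of the family indexed by [nat + nat] says at once that
   the inter-generation times are independent, that the service times are
   independent, and that the two sequences are independent of each other. *)
Record gginf_queue (R : realType)
    (FX FS : probability (measurableTypeR R) R) := GGInfQueue {
  queue_disp : measure_display;
  queue_space : measurableType queue_disp;
  queue_prob : probability queue_space R;
  inter_gen : nat -> {RV queue_prob >-> R};
  service : nat -> {RV queue_prob >-> R};
  inter_gen_dist : forall i, has_distribution (inter_gen i) FX;
  service_dist : forall i, has_distribution (service i) FS;
  queue_indep : mutually_independent
    (fun k : (nat + nat)%type =>
       match k with inl i => inter_gen i | inr i => service i end)
}.

Section queue_quantities.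
Context (R : realType) (FX FS : probability (measurableTypeR R) R).
Variable q : gginf_queue FX FS.

Definition gen_time (i : nat) (w : queue_space q) : R :=
  (\sum_(k < i.+1) inter_gen q k w)%R.

(* Every packet starts service on a server of its own when it is generated. *)
Definition recv_time (i : nat) (w : queue_space q) : R :=
  (gen_time i w + service q i w)%R.

Definition delay (i : nat) (w : queue_space q) : R :=
  (recv_time i w - gen_time i w)%R.

Definition received (t : R) (w : queue_space q) : set nat :=
  [set i | (recv_time i w <= t)%R].

(* Before the first reception the age is [t], i.e. it grows from age 0 at
   time 0.  Afterwards the infimum is almost surely a minimum, since almost
   surely only finitely many packets are generated up to time [t]. *)
Definition age (t : R) (w : queue_space q) : R :=
  if received t w == set0 then t
  else inf [set (t - gen_time i w)%R | i in received t w].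

Definition average_age : \bar R :=
  limf_esup
    (fun T : R => \int[queue_prob q]_w
       ((T^-1)%:E * \int[lebesgue_measure]_(t in `[0%R, T]) (age t w)%:E))
    (pinfty_nbhs R).

(* All delays have the same distribution, so any packet can be used here. *)
Definition delay_variance : \bar R := variance (queue_prob q) (delay 0).

End queue_quantities.

Definition is_inter_gen_dist (R : realType) (lambda : R)
    (FX : probability (measurableTypeR R) R) : Prop :=
  FX [set x : R | (0 < x)%R] = 1 /\ \int[FX]_x x%:E = (lambda^-1)%:E.

Definition is_service_dist (R : realType) (mu : R)
    (FS : probability (measurableTypeR R) R) : Prop :=
  FS [set x : R | (0 <= x)%R] = 1 /\ \int[FS]_x x%:E = (mu^-1)%:E.

(* [Q FS] is any realization of the queue with service distribution [FS]; its
   average age and delay variance depend only on [FX] and [FS]. *)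
Definition min_age (R : realType) (FX : probability (measurableTypeR R) R)
    (mu : R) (Q : forall FS, gginf_queue FX FS) : \bar R :=
  ereal_inf [set average_age (Q FS) | FS in is_service_dist mu].

(* The infimum of the empty set is [+oo]. *)
Definition min_delay_variance (R : realType)
    (FX : probability (measurableTypeR R) R)
    (mu : R) (Q : forall FS, gginf_queue FX FS) (a : \bar R) : \bar R :=
  ereal_inf [set delay_variance (Q FS) |
    FS in [set FS | average_age (Q FS) <= a /\ is_service_dist mu FS]].

(* Main.v *)
Require Import Defs.
From HB Require Import structures.
From mathcomp Require Import all_boot all_order all_algebra.
From mathcomp Require Import all_classical all_reals all_analysis.
From mathcomp Require Import measurable_realfun ring lra.
Set Implicit Arguments.
Unset Strict Implicit.
Unset Printing Implicit Defensive.

Import Order.TTheory GRing.Theory Num.Theory.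
Import numFieldNormedType.Exports.
Local Open Scope classical_set_scope.
Local Open Scope ring_scope.
Local Open Scope ereal_scope.

(* Let [T_i] be the renewal epochs, [G t] the integral over [0, t] of the
   expected age of the renewal process itself (the age when all services are
   instantaneous), and [A0] the limit superior of [G t / t], which depends on
   [FX] only.

   Making services instantaneous except with a small probability [p], when they
   are long enough to restore the mean, adds to the age at most the lengths of
   the cycles in the current run of late packets.  The expected integral of this
   excess is at most [2 p E[X]^2] times the expected number of renewals up to
   [t], which is linear in [t]; hence [min_age <= A0].

   Conversely, a bounded variance and a mean [1 / mu] force
   [P(S > 1 / (2 mu)) >= c0 > 0].  A packet delayed by more than [1 / (2 mu)]
   leaves the age larger, by the length of the preceding cycle, at the beginning
   of its own cycle.  As this happens a positive fraction of the time, the average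
   age is at least [A0 + e], with [e > 0] depending on the variance bound only.
   So the variances must blow up when the average age approaches [min_age].

   The measurability of the age process is never needed: its integrals are only
   compared with those of explicit measurable bounds. *)

Lemma set_gt0E (R : realType) : [set x : R | (0 < x)%R] = `]0%R, +oo[%classic.
Proof. by apply/seteqP; split=> x /=; rewrite in_itv/= andbT. Qed.

Lemma set_ge0E (R : realType) : [set x : R | (0 <= x)%R] = `[0%R, +oo[%classic.
Proof. by apply/seteqP; split=> x /=; rewrite in_itv/= andbT. Qed.

(** * Monotonicity of the integral for possibly nonmeasurable functions *)

Section nonmeasurable_monotonicity.
Context d (T : measurableType d) (R : realType).
Variable mu : {measure set T -> \bar R}.
Implicit Types f g : T -> \bar R.
Import HBNNSimple.

(** The integral of a nonnegative function is a supremum over the simple functions below it,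
    measurable or not. Cutting such a simple function to zero on the null set [N] keeps its integral
    and puts it below [g]. *)
Let ge0_le_integralN (N : set T) f g : measurable N -> mu N = 0 ->
  (forall x, 0 <= f x) -> (forall x, 0 <= g x) ->
  (forall x, ~ N x -> f x <= g x) -> \int[mu]_x f x <= \int[mu]_x g x.
Proof.
move=> mN N0 f0 g0 fg; rewrite !ge0_integralTE//.
apply: ge_ereal_sup => _ [h /= hf <-].
apply: le_ereal_sup_tmp; exists (sintegral mu (proj_nnsfun h (measurableC mN))).
  exists (proj_nnsfun h (measurableC mN)) => // x.
  rewrite /= mindicE; have [xN|xN] := boolP (x \in ~` N).
    rewrite mulr1; apply: le_trans (hf x) _; apply: fg.
    by rewrite inE in xN.
  by rewrite mulr0.
rewrite -!integralT_nnsfun; set h' := proj_nnsfun _ _.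
rewrite (_ : \int[mu]_x (h x)%:E = \int[mu]_x (h' x)%:E)//.
apply: ge0_ae_eq_integral => //.
- by apply/measurable_EFinP.
- by apply/measurable_EFinP.
- by move=> x _; rewrite lee_fin.
- by move=> x _; rewrite lee_fin.
exists N; split=> // x /=; apply: contra_notP => Nx _.
by rewrite /= mindicE (mem_set (Nx : (~` N) x)) mulr1.
Qed.

(** Off [N] the negative parts vanish, so both integrals reduce to those of the positive parts. *)
Lemma le_integral_nonmeasurable (D N : set T) f g : measurable N -> mu N = 0 ->
  (forall x, D x -> ~ N x -> 0 <= f x <= g x) ->
  \int[mu]_(x in D) f x <= \int[mu]_(x in D) g x.
Proof.
move=> mN N0 fg; rewrite (integral_mkcond D f) (integral_mkcond D g).
have {}fg x : ~ N x -> 0 <= (f \_ D) x <= (g \_ D) x.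
  move=> Nx; rewrite /patch; case: ifPn => Dx; rewrite ?lexx//.
  by apply: fg => //; exact: set_mem.
move: (f \_ D) (g \_ D) fg => {}f {}g fg.
have neg0 k : (forall x, ~ N x -> 0 <= k x) -> \int[mu]_x k^\- x = 0.
  move=> k0; apply/eqP; rewrite eq_le integral_ge0// andbT.
  rewrite -[leRHS](integral0 mu setT).
  apply: (@ge0_le_integralN N) => // x Nx.
  by rewrite funenegE/= ge_max lexx andbT leeNl oppe0; exact: k0.
rewrite integralE [leRHS]integralE !neg0 ?sube0.
- apply: (@ge0_le_integralN N) => // x Nx.
  have /andP[f0 fg'] := fg x Nx.
  by rewrite !funeposE/= !max_l// (le_trans f0).
- by move=> x /fg/andP[f0 /(le_trans f0)].
- by move=> x /fg/andP[].
Qed.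

End nonmeasurable_monotonicity.

(** * Pairs of variables that are independent given an event *)

Section pair_on_event.
Context d d1 d2 (T : measurableType d) (T1 : measurableType d1)
  (T2 : measurableType d2) (R : realType) (P : probability T R).
Variables (C : set T) (mC : measurable C).
Variables (U : {mfun T >-> T1}) (V : {mfun T >-> T2}).
Hypothesis indep : forall A B, measurable A -> measurable B ->
  P (C `&` (U @^-1` A `&` V @^-1` B)) = P C * (P (U @^-1` A) * P (V @^-1` B)).

Let UV (x : T) : T1 * T2 := (U x, V x).

Let mUV : measurable_fun setT UV.
Proof. by apply/measurable_fun_pairP; split; exact: measurable_funPT. Qed.

(** Given [C], the law of [(U, V)] agrees with the product measure on rectangles, hence everywhere
    by uniqueness of product measures. Normalising by [P C] sets the case [P C = 0] apart. *)
Lemma probability_pair_event E : measurable E ->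
  P (C `&` [set x | E (U x, V x)]) =
  P C * (distribution P U \x distribution P V) E.
Proof.
move=> mE; have mUVE : measurable (UV @^-1` E).
  by rewrite -[X in measurable X]setTI; exact: mUV.
have [C0|C0] := eqVneq (P C) 0.
  rewrite C0 mul0e; apply/eqP; rewrite eq_le measure_ge0 andbT -C0.
  by apply: le_measure; rewrite ?inE//; exact: measurableI.
have Cfin : P C \is a fin_num by exact: fin_num_measure.
have Cgt0 : (0 < fine (P C))%R.
  by rewrite fine_gt0// lt0e C0 measure_ge0/= ltey_eq Cfin.
have ir0 : (0 <= (fine (P C))^-1)%R by rewrite invr_ge0 ltW.
pose m' := mscale (NngNum ir0) (pushforward (mrestr P mC) UV).
pose m := m' mUV.
rewrite (@product_measure_unique _ _ _ _ _ _ _ m)//.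
  rewrite -[X in _ * X]/(((fine (P C))^-1)%:E * P (UV @^-1` E `&` C)) muleA.
  by rewrite -[P C in X in _ = X * _]fineK// -EFinM mulfV ?gt_eqF// mul1e setIC.
move=> A B mA mB; rewrite -[LHS]/(((fine (P C))^-1)%:E * P (UV @^-1` (A `*` B) `&` C)).
rewrite (_ : _ `&` C = C `&` (U @^-1` A `&` V @^-1` B)).
  by rewrite indep// muleA -[P C]fineK// -EFinM mulVf ?gt_eqF// mul1e.
by rewrite setIC.
Qed.

Lemma integral_pair_event (h : T1 * T2 -> \bar R) :
  measurable_fun setT h -> (forall z, 0 <= h z) ->
  \int[P]_(x in C) h (U x, V x) =
  P C * \int[distribution P U \x distribution P V]_z h z.
Proof.
move=> mh h0.
have C0 : (0 <= fine (P C))%R by exact: fine_ge0.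
have -> : \int[P]_(x in C) h (U x, V x) = \int[mrestr P mC]_x h (UV x).
  rewrite [RHS](ge0_negligible_integral (N := ~` C))//=; last 3 first.
  - exact: measurableC.
  - exact: measurableT_comp.
  - by rewrite /mrestr setICl measure0.
  rewrite setTD setCK; apply: eq_measure_integral => A mA AC.
  by rewrite [RHS](_ : _ = P (A `&` C))// setIidl.
rewrite -(@ge0_integral_pushforward _ _ _ _ _ _ mUV _ setT)//.
rewrite -[P C]fineK ?fin_num_measure//.
rewrite -(ge0_integral_mscale _ measurableT (NngNum C0))//.
apply: eq_measure_integral => E mE _.
transitivity ((fine (P C))%:E * (distribution P U \x distribution P V) E) => //.
by rewrite fineK ?fin_num_measure// -probability_pair_event// setIC.
Qed.

End pair_on_event.

(** * Renewal epochs and their independence of later variables *)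

Section start_times.
Context (R : realType) (FX FS : probability (measurableTypeR R) R).
Variable q : gginf_queue FX FS.
Local Notation P := (queue_prob q).
Local Notation X := (inter_gen q).
Local Notation S := (service q).

(* Packet [i] is generated at time [start_time i.+1]. *)
Definition start_time (i : nat) : {RV P >-> R} :=
  (\sum_(k < i) (X k : {mfun queue_space q >-> R}))%R.

Lemma start_time0 (w : queue_space q) : start_time 0 w = 0%R.
Proof. by rewrite /start_time big_ord0. Qed.

Lemma start_timeS i (w : queue_space q) :
  start_time i.+1 w = (start_time i w + X i w)%R.
Proof. by rewrite /start_time big_ord_recr. Qed.

Lemma gen_timeE i (w : queue_space q) : gen_time i w = start_time i.+1 w.
Proof.
rewrite /gen_time; elim: i => [|i IH].
  by rewrite start_timeS start_time0 big_ord_recr big_ord0.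
by rewrite big_ord_recr IH [RHS]start_timeS.
Qed.

(** The body repeats the family in [queue_indep], so that the product formula for cylinders is an
    instance of that field. *)
Definition innovation (k : nat + nat) : {RV P >-> R} :=
  match k with inl i => X i | inr i => S i end.

Definition cylinder (J : seq (nat + nat)) (B : nat + nat -> set R) :=
  \bigcap_(j in [set` J]) (innovation j @^-1` B j).

Lemma measurable_cylinder J B :
  (forall j, measurable (B j)) -> measurable (cylinder J B).
Proof.
move=> mB; apply: fin_bigcap_measurable; first exact: finite_seq.
by move=> j _; exact: measurable_funPTI.
Qed.

Lemma probability_cylinder J B : uniq J -> (forall j, measurable (B j)) ->
  P (cylinder J B) = \prod_(j <- J) P (innovation j @^-1` B j).
Proof. exact: (@queue_indep _ _ _ q). Qed.

(** By induction, since [T_{i+1} = T_i + X_i]: a condition on [X_i] is absorbed into the cylinder,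
    so the pair [(T_i, X_i)] has a product law given the cylinder, and [T_{i+1}] is a function of
    that pair. *)
Lemma start_time_indep i J B A : uniq J ->
    (forall k, (k < i)%N -> inl k \notin J) ->
    (forall j, measurable (B j)) -> measurable A ->
  P (start_time i @^-1` A `&` cylinder J B) =
  P (start_time i @^-1` A) * P (cylinder J B).
Proof.
elim: i J B A => [|i IH] J B A uJ iJ mB mA.
  have [A0|A0] := pselect (A 0%R).
    rewrite (_ : start_time 0 @^-1` A = setT) ?setTI ?probability_setT ?mul1e//.
    by apply/seteqP; split => // w _; rewrite /preimage/= start_time0.
  rewrite (_ : start_time 0 @^-1` A = set0) ?set0I ?measure0 ?mul0e//.
  by apply/seteqP; split => // w; rewrite /preimage/= start_time0.
pose E : set (R * R) := [set z | A (z.1 + z.2)%R].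
have mE : measurable E.
  rewrite -[X in measurable X]setTI.
  by apply: (measurable_funD measurable_fst measurable_snd).
(* Used for [J] itself and for the empty cylinder, which gives the probability for [start_time i.+1]
   alone. *)
have key J' B' : uniq J' -> (forall k, (k < i.+1)%N -> inl k \notin J') ->
    (forall j, measurable (B' j)) ->
    P (cylinder J' B' `&` start_time i.+1 @^-1` A) =
    P (cylinder J' B') * (distribution P (start_time i) \x distribution P (X i)) E.
  move=> uJ' iJ' mB'.
  rewrite -probability_pair_event//; [|exact: measurable_cylinder|].
    by congr (P (_ `&` _)); apply/seteqP; split=> w; rewrite /preimage/= start_timeS.
  move=> C D mC mD.
  (* [B''] adds the condition that [X i] lies in [D]; the index [inl i] is fresh because [J'] avoids
     all inter-generation indices below [i.+1]. *)
  pose B'' j := if j == inl i then D else B' j.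
  have mB'' j : measurable (B'' j) by rewrite /B''; case: ifP.
  have iJ'' : inl i \notin J' by exact: iJ'.
  have B''E j : j \in J' -> B'' j = B' j.
    by rewrite /B''; case: eqP => // -> jJ; rewrite jJ in iJ''.
  have cE : cylinder J' B'' = cylinder J' B'.
    by apply: eq_bigcapr => j /= jJ; rewrite B''E.
  have cS : cylinder (inl i :: J') B'' = X i @^-1` D `&` cylinder J' B'.
    rewrite /cylinder (_ : [set` inl i :: J'] = [set inl i] `|` [set` J']).
      by rewrite bigcap_setU bigcap_set1 -/(cylinder J' B'') cE /B'' eqxx.
    apply/seteqP; split=> j /=; rewrite inE.
      by move=> /orP[/eqP->|]; [left|right].
    by move=> [->|->]; rewrite ?eqxx ?orbT.
  have uS : uniq (inl i :: J') by rewrite /= iJ''.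
  have iS k : (k < i)%N -> inl k \notin inl i :: J'.
    move=> ki; rewrite inE negb_or iJ' ?andbT; last exact: ltnW.
    by apply/eqP => -[ki']; rewrite ki' ltnn in ki.
  have := IH (inl i :: J') B'' C uS iS mB'' mC.
  rewrite probability_cylinder// big_cons/= {2}/B'' eqxx.
  rewrite -probability_cylinder// cE cS => IHe.
  by rewrite setIC -setIA IHe muleA muleC.
have := key [::] B isT (fun _ _ => isT) mB.
rewrite /cylinder (_ : [set` [::]] = set0) ?bigcap_set0; last first.
  by apply/seteqP; split.
rewrite setTI probability_setT mul1e => PE.
by rewrite setIC key// PE muleC.
Qed.

End start_times.

Arguments cylinder {R FX FS} q J B.

(** * Probabilities and integrals over cylinders *)

Lemma ge0_integral_measurableTypeR (R : realType)
    (F : probability (measurableTypeR R) R) (m : {measure set R -> \bar R})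
    (h : R -> \bar R) :
  (forall A : set R, measurable A -> m A = F A) ->
  measurable_fun setT h -> (forall x, 0 <= h x) ->
  \int[m]_x h x = \int[F]_x h x.
Proof.
move=> mF mh h0.
(* The identity, read as a measurable map between the two measurable structures that the real line
   carries here. *)
pose i : measurableTypeR R -> R := idfun.
have mi : measurable_fun setT i.
  by move=> _ A mA; rewrite setTI; exact: mA.
rewrite -[RHS]/(\int[F]_x (h \o i) x).
rewrite -[X in _ = \int[_]_(_ in X) _](preimage_setT i).
rewrite -ge0_integral_pushforward//.
apply: eq_measure_integral => A mA _.
exact: mF.
Qed.

Section cylinder_probabilities.
Context (R : realType) (FX FS : probability (measurableTypeR R) R).
Variable q : gginf_queue FX FS.
Local Notation P := (queue_prob q).
Local Notation X := (inter_gen q).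
Local Notation S := (service q).
Local Notation T := (start_time q).

Lemma cylinder_cons j J (B : nat + nat -> set R) :
  cylinder q (j :: J) B = innovation q j @^-1` B j `&` cylinder q J B.
Proof.
rewrite /cylinder (_ : [set` j :: J] = [set j] `|` [set` J]).
  by rewrite bigcap_setU bigcap_set1.
apply/seteqP; split=> i /=; rewrite inE.
  by move=> /orP[/eqP->|]; [left|right].
by move=> [->|->]; rewrite ?eqxx ?orbT.
Qed.

Lemma cylinder_nil (B : nat + nat -> set R) : cylinder q [::] B = setT.
Proof.
rewrite /cylinder (_ : [set` [::]] = set0) ?bigcap_set0//.
by apply/seteqP; split.
Qed.

Lemma inter_gen_distE i B : measurable B -> P (X i @^-1` B) = FX B.
Proof. exact: inter_gen_dist. Qed.

Lemma service_distE i B : measurable B -> P (S i @^-1` B) = FS B.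
Proof. exact: service_dist. Qed.

Lemma start_time_inter_gen_indep i A B : measurable A -> measurable B ->
  P (T i @^-1` A `&` X i @^-1` B) = P (T i @^-1` A) * FX B.
Proof.
move=> mA mB.
have := @start_time_indep _ _ _ q i [:: inl i] (fun=> B) A isT.
rewrite cylinder_cons cylinder_nil setIT /= inter_gen_distE//; apply => //.
by move=> k ki; rewrite inE; apply/eqP => -[ki']; rewrite ki' ltnn in ki.
Qed.

Lemma integral_start_time_inter_gen i (h : R * R -> \bar R) :
  measurable_fun setT h -> (forall z, 0 <= h z) ->
  \int[P]_w h (T i w, X i w) =
  \int[distribution P (T i) \x distribution P (X i)]_z h z.
Proof.
move=> mh h0; rewrite integral_pair_event//.
  by rewrite probability_setT mul1e.
move=> A B mA mB; rewrite setTI probability_setT mul1e.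
by rewrite start_time_inter_gen_indep// inter_gen_distE.
Qed.

Lemma integral_inter_gen i (h : R -> \bar R) :
  measurable_fun setT h -> (forall z, 0 <= h z) ->
  \int[P]_w h (X i w) = \int[FX]_x h x.
Proof.
move=> mh h0; rewrite -(ge0_integral_distribution (X i))//.
by apply: ge0_integral_measurableTypeR => // A mA; exact: inter_gen_distE.
Qed.

Lemma integral_service i (h : R -> \bar R) :
  measurable_fun setT h -> (forall z, 0 <= h z) ->
  \int[P]_w h (S i w) = \int[FS]_x h x.
Proof.
move=> mh h0; rewrite -(ge0_integral_distribution (S i))//.
by apply: ge0_integral_measurableTypeR => // A mA; exact: service_distE.
Qed.

(* Packets [k], ..., [k + n - 1] are all late.  The condition on [start_time k]
   keeps the expected number of such runs linear in [t]. *)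
Definition late_run (t : R) k n : set (queue_space q) :=
  T k @^-1` `]-oo, t] `&`
  cylinder q [seq inr j | j <- iota k n] (fun=> `]0%R, +oo[%classic).

Lemma measurable_late_run t k n : measurable (late_run t k n).
Proof.
apply: measurableI; first exact: measurable_funPTI.
by apply: measurable_cylinder.
Qed.

Lemma probability_late_run t k n :
  P (late_run t k n) = P (T k @^-1` `]-oo, t]) * FS `]0%R, +oo[%classic ^+ n.
Proof.
have u : uniq [seq (inr j : nat + nat) | j <- iota k n].
  by rewrite map_inj_uniq ?iota_uniq// => ? ? [].
rewrite start_time_indep//; last first.
  by move=> j _; apply/mapP => -[].
rewrite probability_cylinder// big_map; congr (_ * _).
elim: n k {u} => [|n IH] k; first by rewrite big_nil.
by rewrite big_cons IH expeS; congr (_ * _); rewrite -(service_distE k).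
Qed.

(** The run constrains only services and [start_time k], a function of the cycles before [k]. It is
    therefore independent of [X k] and [X (k + n.+1)], which are independent of each other since
    their indices differ. *)
Lemma integral_late_run t k n :
  \int[P]_(w in late_run t k n.+1) (`|X k w| * `|X (k + n.+1)%N w|)%:E =
  P (late_run t k n.+1) * ((\int[FX]_x `|x|%:E) * (\int[FX]_x `|x|%:E)).
Proof.
pose h (z : R * R) := (`|z.1| * `|z.2|)%:E.
have mh : measurable_fun setT h.
  apply/measurable_EFinP; apply: measurable_funM.
    by apply: (measurableT_comp (@normr_measurable R setT)).
  by apply: (measurableT_comp (@normr_measurable R setT)).
have mabs : measurable_fun [set: R] (fun x => `|x|%:E).
  by apply/measurable_EFinP; exact: normr_measurable.
have dX i : \int[distribution P (X i)]_x `|x|%:E = \int[FX]_x `|x|%:E.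
  by apply: ge0_integral_measurableTypeR => // A mA; exact: inter_gen_distE.
rewrite (integral_pair_event (measurable_late_run t k n.+1) _ mh)//.
- congr (_ * _); rewrite fubini_tonelli1//.
  under eq_integral => x _.
    rewrite /fubini_F /h /=.
    under eq_integral do rewrite EFinM.
    rewrite ge0_integralZl//=.
    rewrite dX.
    over.
  rewrite ge0_integralZr//; last by apply: integral_ge0.
  by rewrite dX.
  by move=> z; rewrite lee_fin mulr_ge0.
- move=> A B mA mB.
  set J := [seq (inr j : nat + nat) | j <- iota k n.+1].
  pose B' (j : nat + nat) : set R :=
    if j == inl k then A else if j == inl (k + n.+1)%N then B else `]0%R, +oo[%classic.
  have mB' j : measurable (B' j) by rewrite /B'; do 2 case: ifP => _ //.
  have uJ : uniq J by rewrite map_inj_uniq ?iota_uniq// => ? ? [].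
  have inlJ j : inl j \notin J by apply/mapP => -[].
  have kn : inl k != inl (k + n.+1)%N :> nat + nat.
    by apply/eqP => -[/eqP]; rewrite -{1}(addn0 k) eqn_add2l.
  have u : uniq [:: inl k, inl (k + n.+1)%N & J].
    by rewrite /= inE negb_or kn !inlJ.
  have cJ : cylinder q J B' = cylinder q J (fun=> `]0%R, +oo[%classic).
    by apply: eq_bigcapr => j /= /mapP[i _ ->].
  have := @start_time_indep _ _ _ q k _ B' `]-oo, t]%classic u _ mB'.
  rewrite probability_cylinder// 2!big_cons -probability_cylinder//.
  rewrite 2!cylinder_cons cJ /B' eqxx eq_sym (negbTE kn) eqxx /= => H.
  rewrite [in RHS]start_time_indep//.
  rewrite /late_run -/J.
  transitivity (P (T k @^-1` `]-oo, t] `&` (X k @^-1` A `&`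
      (X (k + n.+1) @^-1` B `&` cylinder q J (fun=> `]0%R, +oo[%classic))))).
    by congr (P _); rewrite -!setIA; congr (_ `&` _); rewrite setIC -setIA.
  rewrite H//; last first.
    move=> j jk; rewrite 2!in_cons 2!negb_or inlJ andbT; apply/andP; split.
      by apply/eqP => -[jk']; rewrite jk' ltnn in jk.
    apply/eqP => -[jk']; move: jk; rewrite jk' ltnNge leq_addr//.
  rewrite [X in _ * X]muleA [X in _ * X]muleC !muleA//.
- by move=> z; rewrite lee_fin mulr_ge0.
Qed.

Lemma probability_extra_age_event (t s : R) A B i :
  measurable A -> measurable B ->
  P (T i @^-1` `]-oo, t] `&` (X i @^-1` A `&` (X i.+1 @^-1` B `&`
      S i @^-1` `]s, +oo[))) =
  P (T i @^-1` `]-oo, t]) * (FX A * (FX B * FS `]s, +oo[%classic)).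
Proof.
move=> mA mB.
pose D (j : nat + nat) : set R :=
  if j == inl i then A else if j == inl i.+1 then B else `]s, +oo[%classic.
have mD j : measurable (D j) by rewrite /D; do 2 case: ifP => _ //.
have i1 : (inl i.+1 == inl i :> nat + nat) = false.
  by apply/eqP => -[/eqP]; rewrite -{2}(addn0 i) -addn1 eqn_add2l.
have u : uniq [:: inl i; inl i.+1; inr i : nat + nat].
  by rewrite /= !inE !negb_or eq_sym i1.
have := @start_time_indep _ _ _ q i _ D `]-oo, t]%classic u _ mD.
rewrite probability_cylinder// 3!big_cons big_nil mule1.
rewrite 3!cylinder_cons cylinder_nil setIT /D eqxx i1 eqxx /=.
rewrite !inter_gen_distE// service_distE//; apply => //.
move=> j ji; rewrite !inE !negb_or andbT; apply/andP; split.
  by apply/eqP => -[ji']; rewrite ji' ltnn in ji.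
by apply/eqP => -[ji']; move: ji; rewrite ji' ltnNge leqnSn.
Qed.

End cylinder_probabilities.

(** * Linear bounds on the renewal function *)

Lemma nneseries_le (R : realType) (u : (\bar R)^nat) (c : \bar R) :
  (forall i, 0 <= u i) -> (forall n, \sum_(0 <= i < n) u i <= c) ->
  \sum_(i <oo) u i <= c.
Proof.
move=> u0 uc; apply: lime_le; first exact: is_cvg_nneseries.
by apply: nearW => n; exact: uc.
Qed.

Lemma probability_setC0 (R : realType) (F : probability (measurableTypeR R) R)
    (A : set R) : measurable A -> F A = 1 -> F (~` A) = 0.
Proof.
move=> mA FA; have := @probability_setC _ (measurableTypeR R) R F A mA.
by rewrite FA subee.
Qed.

Lemma integral_abs_nonneg (R : realType) (F : probability (measurableTypeR R) R) :
  F [set x : R | (0 <= x)%R] = 1 -> \int[F]_x `|x|%:E = \int[F]_x x%:E.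
Proof.
move=> F1.
have mnneg : measurable [set x : R | (0 <= x)%R] by rewrite set_ge0E.
apply: ae_eq_integral => //.
- by apply/measurable_EFinP; exact: normr_measurable.
- exists (~` [set x : R | (0 <= x)%R]); split.
  + exact: measurableC.
  + exact: probability_setC0.
  + by move=> x /=; apply: contra_not => x0 _; rewrite ger0_norm.
Qed.

Lemma integral_abs_inter_gen_dist (R : realType) (lambda : R)
    (FX : probability (measurableTypeR R) R) :
  is_inter_gen_dist lambda FX -> \int[FX]_x `|x|%:E = (lambda^-1)%:E.
Proof.
move=> [FX1 <-]; apply: integral_abs_nonneg; apply/eqP.
rewrite eq_le probability_le1/=; last by rewrite set_ge0E.
rewrite -FX1; apply: le_measure; rewrite ?inE.
- by rewrite set_gt0E.
- by rewrite set_ge0E.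
- by move=> x /= /ltW.
Qed.

Section renewal.
Context (R : realType) (FX FS : probability (measurableTypeR R) R).
Variable q : gginf_queue FX FS.
Local Notation P := (queue_prob q).
Local Notation X := (inter_gen q).
Local Notation S := (service q).
Local Notation T := (start_time q).

(** One null set serves for all packets at once, so that path-wise arguments may assume these
    signs. *)
Lemma ae_positive :
  FX [set x : R | (0 < x)%R] = 1 -> FS [set x : R | (0 <= x)%R] = 1 ->
  exists N, [/\ measurable N, P N = 0 &
    forall w, ~ N w -> (forall i, 0 < X i w)%R /\ (forall i, 0 <= S i w)%R].
Proof.
rewrite set_gt0E set_ge0E => FX1 FS1.
pose N := (\bigcup_i (X i @^-1` (~` `]0%R, +oo[))) `|`
  \bigcup_i (S i @^-1` (~` `[0%R, +oo[)).
have mXi i : measurable (X i @^-1` (~` `]0%R, +oo[)).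
  by apply: measurable_funPTI; exact: measurableC.
have mSi i : measurable (S i @^-1` (~` `[0%R, +oo[)).
  by apply: measurable_funPTI; exact: measurableC.
have [M [mM M0 NM]] : P.-negligible N.
  apply: negligibleU; apply: negligible_bigcup => i.
    exists (X i @^-1` (~` `]0%R, +oo[)); split=> //.
    transitivity (FX (~` `]0%R, +oo[%classic)); last exact: probability_setC0.
    by apply: inter_gen_distE; exact: measurableC.
  exists (S i @^-1` (~` `[0%R, +oo[)); split=> //.
  transitivity (FS (~` `[0%R, +oo[%classic)); last exact: probability_setC0.
  by apply: service_distE; exact: measurableC.
exists M; split=> // w Mw; have /not_orP[NX NS] : ~ N w by move=> /NM.
split=> i.
  apply/negPn/negP => h; apply: NX; exists i => //=.
  by rewrite in_itv/= andbT; exact/negP.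
apply/negPn/negP => h; apply: NS; exists i => //=.
by rewrite in_itv/= andbT; exact/negP.
Qed.

(** The expected number of renewal epochs up to [t], the epoch 0 included when [0 <= t]. *)
Definition renewal_function (t : R) : \bar R :=
  \sum_(i <oo) P (T i @^-1` `]-oo, t]).

(* A truncated form of Wald's identity. *)
Lemma renewal_function_upper (a t : R) : (0 <= t)%R -> (0 < a)%R ->
  FX [set x : R | (0 < x)%R] = 1 -> FS [set x : R | (0 <= x)%R] = 1 ->
  (a%:E * FX `[a, +oo[%classic) * renewal_function t <= (t + a)%:E.
Proof.
move=> t0 a0 FX1 FS1.
have [N [mN N0 NP]] := ae_positive FX1 FS1.
have Fa : a%:E * FX `[a, +oo[%classic \is a fin_num.
  by rewrite fin_numM// fin_num_measure.
rewrite -[X in X * _]fineK// -nneseriesZl//; apply: nneseries_le.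
  by move=> i; rewrite fineK// mule_ge0// mule_ge0// lee_fin ltW.
move=> n; rewrite fineK//.
pose E i := T i @^-1` `]-oo, t] `&` X i @^-1` `[a, +oo[.
have mE i : measurable (E i) by apply: measurableI; exact: measurable_funPTI.
rewrite (eq_bigr (fun i => \int[P]_w (a * \1_(E i) w)%:E)); last first.
  move=> i _; under eq_integral do rewrite EFinM.
  rewrite ge0_integralZl//; last by rewrite lee_fin ltW.
    rewrite integral_indic// setIT.
    transitivity (a%:E * (P (T i @^-1` `]-oo, t]) * FX `[a, +oo[%classic)).
      by rewrite -muleA; congr (_ * _); rewrite muleC.
    by congr (_ * _); apply/esym/start_time_inter_gen_indep.
  by apply/measurable_EFinP.
rewrite -ge0_integral_sum//; last first.
  by move=> i w _; rewrite lee_fin mulr_ge0// ltW.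
  move=> i; apply/measurable_EFinP; exact: measurable_funM.
rewrite -[leRHS]mule1 -(probability_setT P) -integral_cst//.
apply: (@le_integral_nonmeasurable _ _ _ _ _ N) => // w _ Nw.
rewrite sumEFin !lee_fin; apply/andP; split.
  by apply: sumr_ge0 => i _; rewrite mulr_ge0// ltW.
have {NP Nw}X0 := (NP w Nw).1.
(* Each counted cycle starts by [t] and lasts at least [a]. The bound [T n w] comes from adding up
   lengths, and the bound [t + a] from the start of the last counted cycle. *)
have : (\sum_(0 <= i < n) a * \1_(E i) w <= Num.min (T n w) (t + a))%R.
  elim: n => [|n IH].
    by rewrite big_nil start_time0 le_min lexx addr_ge0// ltW.
  rewrite big_nat_recr//= start_timeS; have Xn := X0 n.
  have [wE|wE] := pselect (E n w).
    rewrite indicE mem_set// mulr1.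
    have : (T n w <= t)%R by have := wE.1; rewrite /= in_itv.
    have : (a <= X n w)%R by have := wE.2; rewrite /= in_itv/= andbT.
    by move: IH; rewrite !le_min => /andP[? ?] ? ?; apply/andP; split; lra.
  rewrite indicE memNset// mulr0 addr0.
  by move: IH; rewrite !le_min => /andP[? ?]; apply/andP; split; lra.
by rewrite le_min => /andP[].
Qed.

(** Markov's inequality, the mean of [|T_i|] being at most [i / lambda]. *)
Lemma start_time_tail (lambda t : R) i : (0 < t)%R ->
  is_inter_gen_dist lambda FX ->
  t%:E * P (T i @^-1` `]t, +oo[) <= (lambda^-1 *+ i)%:E.
Proof.
move=> t0 FXd.
rewrite -[X in _ * P X]setIT -integral_indic//; last exact: measurable_funPTI.
rewrite -ge0_integralZl//; last by rewrite lee_fin ltW.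
  rewrite (_ : (_ *+ i)%:E = \sum_(0 <= k < i) \int[P]_w `|X k w|%:E); last first.
    rewrite (eq_bigr (fun=> (lambda^-1)%:E)).
      by rewrite sumEFin sumr_const_nat subn0.
    move=> k _; rewrite -(integral_abs_inter_gen_dist FXd).
    rewrite (@integral_inter_gen _ _ _ _ k (fun x => `|x|%:E))//.
    by apply/measurable_EFinP; exact: normr_measurable.
  rewrite -ge0_integral_sum//; last first.
    by move=> k; apply/measurable_EFinP; exact: measurableT_comp.
  apply: (@le_integral_nonmeasurable _ _ _ _ _ set0) => // w _ _.
  rewrite -EFinM sumEFin !lee_fin mulr_ge0//= ?(ltW t0)//.
  apply: (@le_trans _ _ `|T i w|%R).
    rewrite indicE; have [|_] := boolP (w \in _); last by rewrite mulr0.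
    by rewrite inE/= in_itv/= andbT mulr1 => /ltW/le_trans; apply; exact: ler_norm.
  elim: i => [|i IH]; first by rewrite start_time0 normr0 big_nil.
  rewrite start_timeS big_nat_recr//=; apply: (le_trans (ler_normD _ _)).
  by rewrite lerD2r.
by apply/measurable_EFinP; apply: measurable_indic; exact: measurable_funPTI.
Qed.

(** By the tail bound, [P(T_i <= t) >= 1/2] for every [i <= lambda t / 2]. Counting [i = 0], there
    are more than [lambda t / 2] such indices. *)
Lemma renewal_function_lower (lambda t : R) : (0 < t)%R -> (0 < lambda)%R ->
  is_inter_gen_dist lambda FX ->
  (lambda * t / 4)%:E <= renewal_function t.
Proof.
move=> t0 l0 FXd.
pose n := (Num.truncn (lambda * t / 2)).+1.
have lt0 : (0 <= lambda * t / 2)%R by rewrite divr_ge0// mulr_ge0// ltW.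
have nlt : (lambda * t / 2 < n%:R)%R by rewrite /n truncnS_gt.
apply: (@le_trans _ _ (\sum_(0 <= i < n) P (T i @^-1` `]-oo, t]))); last first.
  exact: nneseries_lim_ge.
apply: (@le_trans _ _ (\sum_(0 <= i < n) (2^-1)%:E)).
  rewrite sumEFin sumr_const_nat subn0 lee_fin -mulr_natr; lra.
rewrite big_nat_cond [leRHS]big_nat_cond; apply: lee_sum => i.
rewrite andbT => /andP[_]; rewrite ltnS => it.
have {}it : (i%:R <= lambda * t / 2)%R.
  by rewrite -truncn_ge_nat.
have mT : measurable (T i @^-1` `]-oo, t]) by exact: measurable_funPTI.
have := start_time_tail i t0 FXd.
have -> : T i @^-1` `]t, +oo[ = ~` (T i @^-1` `]-oo, t]).
  by apply/seteqP; split=> w; rewrite /preimage/= !in_itv/= andbT ltNge => /negP.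
rewrite probability_setC//.
have /fineK <- : P (T i @^-1` `]-oo, t]) \is a fin_num by exact: fin_num_measure.
rewrite -EFinB -EFinM !lee_fin.
set p := fine _ => H; rewrite -mulr_natr in H.
have H2 : (lambda^-1 * i%:R <= t / 2)%R by rewrite ler_pdivrMl//; lra.
have H3 : (t * (1 - p) <= t * 2^-1)%R by exact: le_trans H H2.
by move: H3; rewrite ler_pM2l//; lra.
Qed.

End renewal.

(** * The area under the age over one renewal cycle *)

Section wait_area.
Context (R : realType).
Implicit Types (t s : R) (z : R * R).

(* [z.1] is the beginning of a renewal cycle and [z.2] its length. *)
Definition in_cycle t z s : bool :=
  [&& (0 <= s)%R, (s <= t)%R, (z.1 <= s)%R & (s < z.1 + z.2)%R].

(** The age within one cycle if services were instantaneous, cut to [[0, t]]. Taking the pair [z] as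
    argument lets Tonelli's theorem give the measurability of the area in [z]. *)
Definition cycle_age t z s : R := if in_cycle t z s then (s - z.1)%R else 0%R.

Definition cycle_area t z : \bar R :=
  \int[lebesgue_measure]_s (cycle_age t z s)%:E.

Lemma cycle_age_ge0 t z s : (0 <= cycle_age t z s)%R.
Proof. by rewrite /cycle_age; case: ifPn => // /and4P[_ _]; rewrite subr_ge0. Qed.

Lemma cycle_area_ge0 t z : 0 <= cycle_area t z.
Proof. by apply: integral_ge0 => s _; rewrite lee_fin cycle_age_ge0. Qed.

Let measurable_cycle_age_uncurried t :
  measurable_fun setT
    (fun p : (R * R) * measurableTypeR R => cycle_age t p.1 p.2).
Proof.
have m2 : measurable_fun setT (fun p : (R * R) * measurableTypeR R => p.2 : R).
  exact: (@measurable_snd _ _ (R * R)%type (measurableTypeR R)).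
have m11 : measurable_fun setT (fun p : (R * R) * measurableTypeR R => p.1.1).
  exact: (measurableT_comp measurable_fst measurable_fst).
have m12 : measurable_fun setT (fun p : (R * R) * measurableTypeR R => p.1.2).
  exact: (measurableT_comp measurable_snd measurable_fst).
apply: measurable_fun_ifT => //; last exact: measurable_funB.
rewrite /in_cycle; repeat apply: measurable_and.
- exact: measurable_fun_ler.
- exact: measurable_fun_ler.
- exact: measurable_fun_ler.
- by apply: measurable_fun_ltr => //; exact: measurable_funD.
Qed.

Lemma measurable_cycle_age t z : measurable_fun setT
  (cycle_age t z : measurableTypeR R -> R).
Proof.
by apply: (measurableT_comp (measurable_cycle_age_uncurried t) (pair1_measurable z)).
Qed.

Lemma measurable_cycle_area t : measurable_fun setT (cycle_area t).
Proof.
apply: (@measurable_fun_fubini_tonelli_F _ _ _ _ _ lebesgue_measure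
  (fun p : (R * R) * measurableTypeR R => (cycle_age t p.1 p.2)%:E)).
  by apply/measurable_EFinP; exact: measurable_cycle_age_uncurried.
by move=> p; rewrite lee_fin cycle_age_ge0.
Qed.

End wait_area.

(** * The renewal area as a function of the inter-generation law *)

Section renewal_area.
Context (R : realType) (FX : probability (measurableTypeR R) R).

(** [G t] of the overview, summed cycle by cycle. *)
Definition renewal_area (FS : probability (measurableTypeR R) R)
    (q : gginf_queue FX FS) (t : R) : \bar R :=
  \sum_(i <oo) \int[queue_prob q]_w
     cycle_area t (start_time q i w, inter_gen q i w).

Lemma measurable_queue_cycle_area FS (q : gginf_queue FX FS) t i :
  measurable_fun setT (fun w => cycle_area t (start_time q i w, inter_gen q i w)).
Proof.
apply: (measurableT_comp (measurable_cycle_area t)).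
by apply/measurable_fun_pairP; split; exact: measurable_funPT.
Qed.

Lemma renewal_area_ge0 FS (q : gginf_queue FX FS) t : 0 <= renewal_area q t.
Proof.
by apply: nneseries_ge0 => i _ _; apply: integral_ge0 => w _; exact: cycle_area_ge0.
Qed.

Lemma eq_product_distribution FS FS' (q : gginf_queue FX FS)
    (q' : gginf_queue FX FS') i (E : set (R * R)) :
  (forall A, measurable A -> distribution (queue_prob q) (start_time q i) A =
     distribution (queue_prob q') (start_time q' i) A) ->
  measurable E ->
  (distribution (queue_prob q) (start_time q i) \x
     distribution (queue_prob q) (inter_gen q i)) E =
  (distribution (queue_prob q') (start_time q' i) \x
     distribution (queue_prob q') (inter_gen q' i)) E.
Proof.
move=> TE mE.
apply: (product_measure_unique
  (m' := distribution (queue_prob q') (start_time q' i) \x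
     distribution (queue_prob q') (inter_gen q' i))) => // A B mA mB.
transitivity (distribution (queue_prob q') (start_time q' i) A *
    distribution (queue_prob q') (inter_gen q' i) B).
  exact: product_measure1E.
congr (_ * _); first exact/esym/TE.
transitivity (FX B); first exact: inter_gen_distE.
exact/esym/inter_gen_distE.
Qed.

(** The law of [T_{i+1}] is the image under addition of the product of the laws of [T_i] and [X_i],
    hence by recursion it is determined by [FX]. *)
Lemma start_time_dist FS FS' (q : gginf_queue FX FS)
    (q' : gginf_queue FX FS') i (A : set R) : measurable A ->
  distribution (queue_prob q) (start_time q i) A =
  distribution (queue_prob q') (start_time q' i) A.
Proof.
elim: i A => [|i IH] A mA.
  rewrite /distribution /pushforward.
  have [A0|A0] := pselect (A 0%R).
    rewrite (_ : start_time q 0 @^-1` A = setT) ?probability_setT; last first.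
      by apply/seteqP; split => // w _; rewrite /preimage/= start_time0.
    rewrite (_ : start_time q' 0 @^-1` A = setT) ?probability_setT//.
    by apply/seteqP; split => // w _; rewrite /preimage/= start_time0.
  rewrite (_ : start_time q 0 @^-1` A = set0) ?measure0; last first.
    by apply/seteqP; split => // w; rewrite /preimage/= start_time0.
  rewrite (_ : start_time q' 0 @^-1` A = set0) ?measure0//.
  by apply/seteqP; split => // w; rewrite /preimage/= start_time0.
pose E : set (R * R) := [set z | A (z.1 + z.2)%R].
have mE : measurable E.
  rewrite -[X in measurable X]setTI.
  by apply: (measurable_funD measurable_fst measurable_snd).
have key FS0 (q0 : gginf_queue FX FS0) :
    distribution (queue_prob q0) (start_time q0 i.+1) A =
    (distribution (queue_prob q0) (start_time q0 i) \x
     distribution (queue_prob q0) (inter_gen q0 i)) E.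
  rewrite -[RHS]mul1e -(probability_setT (queue_prob q0)).
  rewrite -probability_pair_event// ?setTI.
    congr (queue_prob q0 _); apply/seteqP.
    by split=> w; rewrite /preimage/= start_timeS.
  move=> B C mB mC; rewrite setTI probability_setT mul1e.
  by rewrite start_time_inter_gen_indep// inter_gen_distE.
by rewrite !key; exact: eq_product_distribution.
Qed.

(** Queues with different service laws may live on different probability spaces; this provides the
    common reference with which their ages are compared. *)
Lemma eq_renewal_area FS FS' (q : gginf_queue FX FS)
    (q' : gginf_queue FX FS') t : renewal_area q t = renewal_area q' t.
Proof.
apply: eq_eseriesr => i _.
rewrite !(integral_start_time_inter_gen _ _ (@measurable_cycle_area R t))//;
  try by move=> z; exact: cycle_area_ge0.
apply: eq_measure_integral => E mE _; apply: eq_product_distribution => //.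
by move=> A mA; exact: start_time_dist.
Qed.

End renewal_area.

(** * Path-wise lower bound on the age *)

Lemma nneseries_single_le (R : realType) (u : (\bar R)^nat) (p : pred nat) c :
  0 <= c -> (forall i, 0 <= u i) -> (forall i, ~~ p i -> u i = 0) ->
  (forall i j, p i -> p j -> i = j) -> (forall i, p i -> u i <= c) ->
  \sum_(i <oo) u i <= c.
Proof.
move=> c0 u0 pu pE uc; have [[i pi]|np] := pselect (exists i, p i).
  rewrite (@nneseriesD1 _ _ i)// [X in _ + X]eseries0 ?adde0; first exact: uc.
  move=> j _ /= /negP ji; apply: pu; apply/negP => pj; apply: ji.
  by apply/eqP; exact: pE.
rewrite eseries0// => i _ _; apply: pu; apply/negP => pi; apply: np.
by exists i.
Qed.

Section sample_paths.
Context (R : realType) (FX FS : probability (measurableTypeR R) R).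
Variable q : gginf_queue FX FS.
Local Notation P := (queue_prob q).
Local Notation X := (inter_gen q).
Local Notation S := (service q).
Local Notation T := (start_time q).
Variable w : queue_space q.
Hypothesis X_gt0 : forall i, (0 < X i w)%R.
Hypothesis S_ge0 : forall i, (0 <= S i w)%R.

Lemma ler_start_time i j : (i <= j)%N -> (T i w <= T j w)%R.
Proof.
move=> /subnK <-; elim: (j - i)%N => [//|n IH].
by rewrite addSn start_timeS; have := X_gt0 (n + i)%N; lra.
Qed.

Lemma start_time_ge0 i : (0 <= T i w)%R.
Proof. by rewrite -(start_time0 w); exact: ler_start_time. Qed.

Lemma start_time_lt i j : (T i w < T j w)%R -> (i < j)%N.
Proof.
by move=> Tij; rewrite ltnNge; apply/negP => /ler_start_time; rewrite leNgt Tij.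
Qed.

Lemma receivedE s k : received s w k = (T k.+1 w + S k w <= s)%R :> Prop.
Proof. by rewrite /received /= /recv_time gen_timeE. Qed.

Lemma in_cycle_inj t s i j : in_cycle t (T i w, X i w) s ->
  in_cycle t (T j w, X j w) s -> i = j.
Proof.
move=> /and4P[_ _ /= i1 i2] /and4P[_ _ /= j1 j2].
have h1 : (i < j.+1)%N by apply: start_time_lt; rewrite start_timeS; lra.
have h2 : (j < i.+1)%N by apply: start_time_lt; rewrite start_timeS; lra.
by apply/eqP; rewrite eqn_leq -ltnS h1 -ltnS h2.
Qed.

(** Packet [k] is generated at [start_time k.+1], so every received [k < m] was generated by
    [start_time m]. If nothing has been received, the age is [s] itself. *)
Lemma age_ge m s : (0 <= s)%R ->
  (forall k, received s w k -> (k < m)%N) -> (s - T m w <= age s w)%R.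
Proof.
move=> s0 sm; rewrite /age; case: ifPn => [_|/set0P[k0 sk0]].
  by have := start_time_ge0 m; lra.
apply: lb_le_inf; first by exists (s - gen_time k0 w)%R; exists k0.
move=> _ [k /sm km <-]; rewrite gen_timeE lerB//; exact: ler_start_time.
Qed.

Lemma age_ge0 s : (0 <= s)%R -> (0 <= age s w)%R.
Proof.
move=> s0; rewrite /age; case: ifPn => // /set0P[k0 sk0].
apply: lb_le_inf; first by exists (s - gen_time k0 w)%R; exists k0.
move=> _ [k + <-]; rewrite receivedE gen_timeE.
by have := S_ge0 k; lra.
Qed.

Lemma in_cycle_received t s i k : in_cycle t (T i w, X i w) s ->
  received s w k -> (k < i)%N.
Proof.
move=> /and4P[_ _ /= i1 i2]; rewrite receivedE => ks.
rewrite -ltnS; apply: start_time_lt; rewrite (start_timeS i).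
by have := S_ge0 k; lra.
Qed.

Lemma cycle_age_le t s i : in_cycle t (T i w, X i w) s ->
  (cycle_age t (T i w, X i w) s <= age s w)%R.
Proof.
move=> is_; rewrite /cycle_age is_; apply: age_ge; first by have /and4P[] := is_.
by move=> k; exact: in_cycle_received is_.
Qed.

Section extra.
Variables (t a b s0 : R).
Hypotheses (a0 : (0 < a)%R) (as0 : (a <= s0)%R).

(** On this event the age exceeds the renewal age by at least [a] during [[T_{i+1}, T_{i+1} + a[]:
    packet [i] is still in service, missing it costs the preceding cycle, and the next cycle
    outlasts the window. The bounds [b] and [t - b - s0] keep the window inside [[0, t]]. *)
Definition extra_age_event i : set (queue_space q) :=
  T i @^-1` `]-oo, (t - b - s0)%R] `&` (X i @^-1` `[a, b] `&`
    (X i.+1 @^-1` `[a, +oo[ `&` S i @^-1` `]s0, +oo[)).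

Definition extra_age i (s : R) : R :=
  (a * \1_(extra_age_event i) w * \1_(`[T i.+1 w, T i.+1 w + a[%classic) s)%R.

Lemma extra_age_ge0 i s : (0 <= extra_age i s)%R.
Proof. by rewrite /extra_age !mulr_ge0// ltW. Qed.

Lemma extra_age_eventP i : extra_age_event i w ->
  [/\ (T i w <= t - b - s0)%R, (a <= X i w <= b)%R,
      (a <= X i.+1 w)%R & (s0 < S i w)%R].
Proof. by case=> [/= + [/= + [/= + /=]]]; rewrite !in_itv/= !andbT. Qed.

Lemma extra_age_support i s : extra_age i s != 0%R ->
  [/\ extra_age_event i w, in_cycle t (T i.+1 w, X i.+1 w) s,
      (s < T i.+1 w + s0)%R & extra_age i s = a].
Proof.
rewrite /extra_age !indicE.
have [/set_mem iw|_] := boolP (w \in _); last by rewrite mulr0 mul0r eqxx.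
have [/set_mem /=|_] := boolP (s \in _); last by rewrite !mulr0 eqxx.
rewrite in_itv/= => /andP[s1 s2] _; rewrite !mulr1; split=> //; last by have := as0; lra.
have [] := extra_age_eventP iw.
have := start_time_ge0 i.+1; rewrite /in_cycle /= start_timeS in s1 s2 *.
by move=> ? ? /andP[? ?] ? ?; have ? := as0; apply/and4P; split; lra.
Qed.

Lemma age_lower_bound s : (0 <= s <= t)%R ->
  \sum_(i <oo) (cycle_age t (T i w, X i w) s)%:E +
  \sum_(i <oo) (extra_age i s)%:E <= (age s w)%:E.
Proof.
move=> /andP[sge0 st]; have age0 := age_ge0 sge0.
pose p i := in_cycle t (T i w, X i w) s.
have [[i pi]|np] := pselect (exists i, p i); last first.
  have np' i : ~~ p i by apply/negP => pi; apply: np; exists i.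
  rewrite eseries0; last by move=> i _ _; rewrite /cycle_age -/(p i) (negbTE (np' i)).
  rewrite add0e eseries0; first by rewrite lee_fin.
  move=> i _ _; congr EFin; apply/eqP/negPn/negP => /extra_age_support[_ h _ _].
  by move: (np' i.+1); rewrite /p h.
pose c := (s - T i w)%R.
have c0 : (0 <= c)%R by have /and4P[_ _ /=] := pi; rewrite subr_ge0.
(* The age splits into the renewal age [c] and an excess. Cycles being disjoint, each series has at
   most one nonzero term at time [s], and only that term has to be bounded. *)
rewrite -(subrK c (age s w)) EFinD [leRHS]addeC; apply: leeD; last first.
  apply: (@nneseries_single_le _ _ (fun j => extra_age j s != 0%R)).
  - by rewrite lee_fin subr_ge0; have := cycle_age_le pi; rewrite /cycle_age -/(p i) pi.
  - by move=> j; rewrite lee_fin extra_age_ge0.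
  - by move=> j; rewrite negbK => /eqP ->.
  - move=> j k /extra_age_support[_ jp _ _] /extra_age_support[_ kp _ _].
    by have [] := in_cycle_inj jp kp.
  - move=> j /extra_age_support[jE jp js ->].
    have ij := in_cycle_inj pi jp; rewrite /c ij in pi *.
    have [_ /andP[aX _] _ sS] := extra_age_eventP jE.
    (* Packet [j] is received only after [T_{j+1} + s0 > s], so every packet received by [s] was
       generated by [T_j]. *)
    have : (s - T j w <= age s w)%R.
      apply: age_ge => // k kr; have := in_cycle_received pi kr.
      rewrite ltnS leq_eqVlt => /orP[/eqP kj|//].
      by move: kr; rewrite receivedE kj => kr; exfalso; lra.
    by rewrite lee_fin start_timeS; lra.
apply: (@nneseries_single_le _ _ p) => //.
- by move=> j; rewrite lee_fin cycle_age_ge0.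
- by move=> j /negbTE; rewrite /p /cycle_age => ->.
- by move=> j k; exact: in_cycle_inj.
- by move=> j pj; rewrite /cycle_age -/(p j) pj /c (in_cycle_inj pi pj).
Qed.

Lemma measurable_extra_age i :
  measurable_fun setT (extra_age i : measurableTypeR R -> R).
Proof.
apply: measurable_funM; first exact: measurable_cst.
by apply: measurable_indic.
Qed.

Lemma integral_extra_age i :
  \int[lebesgue_measure]_s (extra_age i s)%:E =
  (a ^+ 2 * \1_(extra_age_event i) w)%:E.
Proof.
under eq_integral do rewrite /extra_age EFinM.
rewrite ge0_integralZl//; last 2 first.
- by apply/measurable_EFinP; exact: measurable_indic.
- by rewrite lee_fin mulr_ge0// ltW.
rewrite integral_indic// setIT.
rewrite [X in _ * X](_ : _ = a%:E); last first.
  apply: (etrans (lebesgue_measure_itv _)).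
  by rewrite /= lte_fin ltrDl a0 -EFinD addrAC subrr add0r.
by rewrite -EFinM; congr EFin; ring.
Qed.

Lemma integral_age_lower_bound :
  \sum_(i <oo) cycle_area t (T i w, X i w) +
  \sum_(i <oo) (a ^+ 2 * \1_(extra_age_event i) w)%:E <=
  \int[lebesgue_measure]_(s in `[0%R, t]) (age s w)%:E.
Proof.
rewrite (eq_eseriesr (fun i _ => esym (integral_extra_age i))).
have mc i : measurable_fun setT
    (fun s : measurableTypeR R => (cycle_age t (T i w, X i w) s)%:E).
  by apply/measurable_EFinP; exact: measurable_cycle_age.
have me i : measurable_fun setT (fun s : measurableTypeR R => (extra_age i s)%:E).
  by apply/measurable_EFinP; exact: measurable_extra_age.
rewrite /cycle_area -integral_nneseries//; last first.
  by move=> i s _; rewrite lee_fin cycle_age_ge0.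
rewrite -integral_nneseries//; last first.
  by move=> i s _; rewrite lee_fin extra_age_ge0.
have c0 s : 0 <= \sum_(i <oo) (cycle_age t (T i w, X i w) s)%:E.
  by apply: nneseries_ge0 => i _ _; rewrite lee_fin cycle_age_ge0.
have e0 s : 0 <= \sum_(i <oo) (extra_age i s)%:E.
  by apply: nneseries_ge0 => i _ _; rewrite lee_fin extra_age_ge0.
rewrite -ge0_integralD//; last 2 first.
- apply: ge0_emeasurable_sum => // i s _ _; rewrite lee_fin cycle_age_ge0//.
- apply: ge0_emeasurable_sum => // i s _ _; rewrite lee_fin extra_age_ge0//.
rewrite [leRHS]integral_mkcond.
apply: (@le_integral_nonmeasurable _ _ _ _ _ set0) => // s _ _.
rewrite adde_ge0//=; rewrite patchE; case: ifPn => [/set_mem|].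
  by rewrite /= in_itv/= => /age_lower_bound.
rewrite notin_setE/= in_itv/= => /negP st.
(* Outside [[0, t]] both series vanish, since [in_cycle] includes [0 <= s <= t]. *)
have np i : ~~ in_cycle t (T i w, X i w) s.
  by apply: contra st => /and4P[-> ->].
rewrite eseries0; last by move=> i _ _; rewrite /cycle_age (negbTE (np i)).
rewrite add0e eseries0// => i _ _; congr EFin.
apply/eqP/negPn/negP => /extra_age_support[_ h _ _].
by move: (np i.+1); rewrite h.
Qed.

End extra.

End sample_paths.

(** * Lower bound on the mean age *)

Section mean_age_lower.
Context (R : realType) (FX FS : probability (measurableTypeR R) R).
Variable q : gginf_queue FX FS.
Local Notation P := (queue_prob q).

(** The expectation of the path-wise bound. Independence factors the probability of each extra-age
    event, and summation over [i] produces the renewal function; [a ^+ 2] is an extra age [a] over a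
    window of length [a]. *)
Lemma mean_age_lower_bound (t a b s0 : R) : (0 < t)%R -> (0 < a)%R -> (a <= s0)%R ->
  FX [set x : R | (0 < x)%R] = 1 -> FS [set x : R | (0 <= x)%R] = 1 ->
  (t^-1)%:E * (renewal_area q t +
    (a ^+ 2)%:E * (FX `[a, b]%classic *
      (FX `[a, +oo[%classic * FS `]s0, +oo[%classic)) *
        renewal_function q (t - b - s0)) <=
  \int[P]_w ((t^-1)%:E * \int[lebesgue_measure]_(s in `[0%R, t]) (age s w)%:E).
Proof.
move=> t0 a0 as0 FX1 FS1.
have [N [mN N0 NP]] := ae_positive q FX1 FS1.
pose E i : set (queue_space q) := extra_age_event t a b s0 i.
have mE i : measurable (E i).
  by do 3! (apply: measurableI; first exact: measurable_funPTI); exact: measurable_funPTI.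
have mc i := measurable_queue_cycle_area (q := q) t i.
have c0 i w : 0 <= cycle_area t (start_time q i w, inter_gen q i w).
  exact: cycle_area_ge0.
have e0 i (w : queue_space q) : 0 <= (a ^+ 2 * \1_(E i) w)%:E.
  by rewrite lee_fin mulr_ge0// sqr_ge0.
have me i : measurable_fun setT (fun w => (a ^+ 2 * \1_(E i) w)%:E).
  by apply/measurable_EFinP; exact: measurable_funM.
rewrite /renewal_area /renewal_function -integral_nneseries//.
have -> : (a ^+ 2)%:E * (FX `[a, b]%classic *
    (FX `[a, +oo[%classic * FS `]s0, +oo[%classic)) *
  \sum_(i <oo) P (start_time q i @^-1` `]-oo, (t - b - s0)%R]) =
  \int[P]_w \sum_(i <oo) (a ^+ 2 * \1_(E i) w)%:E.
  rewrite integral_nneseries//.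
  set c := (X in X * _ = _).
  have cf : c \is a fin_num by rewrite /c !fin_numM// fin_num_measure.
  rewrite -(fineK cf) -nneseriesZl//; apply: eq_eseriesr => i _.
  under eq_integral do rewrite EFinM.
  rewrite ge0_integralZl//; last 2 first.
  - by apply/measurable_EFinP; exact: measurable_indic.
  - by rewrite lee_fin sqr_ge0.
  rewrite integral_indic// setIT fineK//.
  rewrite [X in _ = _ * X](@probability_extra_age_event _ _ _ q (t - b - s0)%R s0
    `[a, b]%classic `[a, +oo[%classic i)//.
  by rewrite /c muleAC -muleA; congr (_ * _); rewrite muleC.
have ms : measurable_fun setT
    (fun w => \sum_(i <oo) cycle_area t (start_time q i w, inter_gen q i w)).
  exact: ge0_emeasurable_sum.
have ms' : measurable_fun setT (fun w => \sum_(i <oo) (a ^+ 2 * \1_(E i) w)%:E).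
  exact: ge0_emeasurable_sum.
have s0' w : 0 <= \sum_(i <oo) cycle_area t (start_time q i w, inter_gen q i w).
  exact: nneseries_ge0.
have s0'' (w : queue_space q) : 0 <= \sum_(i <oo) (a ^+ 2 * \1_(E i) w)%:E.
  exact: nneseries_ge0.
rewrite -ge0_integralD// -ge0_integralZl//; last 3 first.
- exact: emeasurable_funD.
- by move=> w _; exact: adde_ge0.
- by rewrite lee_fin invr_ge0 ltW.
apply: (@le_integral_nonmeasurable _ _ _ _ _ N) => // w _ Nw.
have ti : 0 <= (t^-1)%:E :> \bar R by rewrite lee_fin invr_ge0 ltW.
rewrite mule_ge0//= ?adde_ge0//; apply: lee_wpmul2l => //.
have [X0 S0] := NP w Nw.
exact: integral_age_lower_bound.
Qed.

End mean_age_lower.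

(** * Path-wise upper bound on the age *)

Lemma nneseries_ge_term (R : realType) (u : (\bar R)^nat) i :
  (forall i, 0 <= u i) -> u i <= \sum_(i <oo) u i.
Proof.
move=> u0; rewrite (@nneseriesD1 _ _ i)// leeDl//.
exact: nneseries_ge0.
Qed.

(** The inner sums [s_j] satisfy [s_{j+1} = p (s_j + r_j)]. The bound [2 p c <= c] on the sum of the
    [s_j] and the bound [c] on the sum of the [r_j] then give [p (c + c)] again. *)
Lemma geometric_convolution_le (R : realType) (r : nat -> R) (p c : R) n :
  (0 <= p)%R -> (p *+ 2 <= 1)%R -> (0 <= c)%R ->
  (forall n, \sum_(0 <= k < n) r k <= c)%R ->
  (\sum_(0 <= j < n) \sum_(0 <= k < j) r k * p ^+ (j - k) <= p *+ 2 * c)%R.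
Proof.
move=> p0 p1 c0 rc.
have step j : (\sum_(0 <= k < j.+1) r k * p ^+ (j.+1 - k) =
    p * ((\sum_(0 <= k < j) r k * p ^+ (j - k)) + r j))%R.
  rewrite big_nat_recr//= subSnn expr1 mulrDr (mulrC p (r j)); congr (_ + _)%R.
  rewrite big_distrr/= big_nat_cond [RHS]big_nat_cond; apply: eq_bigr => k.
  by rewrite andbT => /andP[_ kj]; rewrite subSn 1?ltnW// exprS mulrCA.
elim: n => [|n IH]; first by rewrite big_nil mulr_ge0// mulrn_wge0.
rewrite big_nat_recl//= big_nil add0r.
under eq_bigr do rewrite step.
rewrite -big_distrr/= big_split/=; have := rc n.
set A := (\sum_(0 <= i < n) r i)%R; set B := (X in (X + A)%R) => Ac.
have BA : (B + A <= c *+ 2)%R.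
  have : (p *+ 2 * c <= 1 * c)%R by exact: ler_wpM2r.
  by rewrite /B; lra.
apply: (@le_trans _ _ (p * (c *+ 2))%R); first exact: ler_wpM2l.
by rewrite mulrnAl mulrnAr.
Qed.

Section sample_path_upper.
Context (R : realType) (FX FS : probability (measurableTypeR R) R).
Variable q : gginf_queue FX FS.
Local Notation P := (queue_prob q).
Local Notation X := (inter_gen q).
Local Notation S := (service q).
Local Notation T := (start_time q).
Variable w : queue_space q.
Hypothesis X_gt0 : forall i, (0 < X i w)%R.
Hypothesis S_ge0 : forall i, (0 <= S i w)%R.

Lemma late_runP t k n : late_run t k n w <->
  (T k w <= t)%R /\ forall j, (k <= j < k + n)%N -> (0 < S j w)%R.
Proof.
rewrite /late_run /cylinder; split=> [[/=]|[Tk Sk]].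
  rewrite in_itv/= => Tk cyl; split=> // j jk.
  have := cyl (inr j); rewrite /= in_itv/= andbT; apply.
  by apply/mapP; exists j => //; rewrite mem_iota.
split; first by rewrite /= in_itv.
move=> _ /= /mapP[j + ->]; rewrite mem_iota => /Sk Sj.
by rewrite /= in_itv/= andbT.
Qed.

(* The total length of the cycles that precede the [i]-th one in the current run
   of late packets. *)
Definition inherited_age t i : R :=
  (\sum_(0 <= k < i) X k w * \1_(late_run t k (i - k)) w)%R.

Lemma inherited_age_ge0 t i : (0 <= inherited_age t i)%R.
Proof. by apply: sumr_ge0 => k _; rewrite mulr_ge0// ltW. Qed.

Lemma age_le_received s k : received s w k -> (age s w <= s - T k.+1 w)%R.
Proof.
move=> sk; rewrite /age ifF; last by apply/negbTE/set0P; exists k.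
apply: ge_inf; last by exists k => //; rewrite gen_timeE.
exists 0%R => _ [j + <-]; rewrite receivedE gen_timeE.
by have := S_ge0 j; lra.
Qed.

Lemma age_le s : (0 <= s)%R -> (age s w <= s)%R.
Proof.
move=> s0; have [r0|/set0P[k sk]] := eqVneq (received s w) set0.
  by rewrite /age r0 eqxx.
apply: le_trans (age_le_received sk) _.
by have := start_time_ge0 X_gt0 k.+1; lra.
Qed.

(** By induction on [i]. If packet [i] has zero service time, it is received at [T_{i+1}] and the
    inherited age may be dropped; otherwise the bound for [i] persists and [X_i] is inherited. This
    is why the bound covers every [s >= T_i] up to [t] and not just one cycle. *)
Lemma age_le_inherited t s i : (T i w <= s <= t)%R ->
  (age s w <= s - T i w + inherited_age t i)%R.
Proof.
elim: i => [|i IH] /andP[Tis st].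
  rewrite start_time0 subr0 /inherited_age big_nil addr0; apply: age_le.
  by rewrite start_time0 in Tis.
have [Si|Si] := ltP 0%R (S i w); last first.
  have : received s w i.
    by rewrite receivedE; have := S_ge0 i; lra.
  move=> /age_le_received/le_trans; apply; rewrite lerDl.
  exact: inherited_age_ge0.
have Xi := X_gt0 i.
have Tis' : (T i w <= s <= t)%R by rewrite start_timeS in Tis; lra.
apply: le_trans (IH Tis') _.
(* The late packet [i] prolongs each earlier run and starts a new run of length one. *)
suff : (inherited_age t i + X i w <= inherited_age t i.+1)%R.
  by rewrite start_timeS; lra.
rewrite /inherited_age big_nat_recr//= subSnn; apply: lerD.
  rewrite big_nat_cond [leRHS]big_nat_cond; apply: ler_sum => k.
  rewrite andbT => /andP[_ ki]; rewrite ler_wpM2l//; first exact: ltW.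
  rewrite [leLHS]indicE; case: (boolP (w \in _)) => // /set_mem/late_runP[Tk Sk].
  rewrite indicE mem_set//; apply/late_runP; split=> // j.
  rewrite subnKC; last by rewrite ltnW// ltnS ltnW.
  move=> /andP[kj]; rewrite ltnS leq_eqVlt => /orP[/eqP->//|ji].
  by apply: Sk; rewrite subnKC ?kj// ltnW.
rewrite indicE mem_set ?mulr1//; apply/late_runP; split.
  by case/andP: Tis' => /le_trans h /h.
by move=> j; rewrite addn1 ltnS -eqn_leq => /eqP <-.
Qed.

Lemma exists_in_cycle t s : (exists n, t < T n w)%R -> (0 <= s <= t)%R ->
  exists i, in_cycle t (T i w, X i w) s.
Proof.
move=> [n tn] /andP[s0 st].
have ex : exists n, (s < T n w)%R by exists n; exact: le_lt_trans tn.
case: (ex_minnP ex) => -[|i] si imin; first by rewrite start_time0 ltNge s0 in si.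
exists i; rewrite /in_cycle s0 st/= -start_timeS si andbT leNgt.
by apply/negP => /imin; rewrite ltnn.
Qed.

Lemma integral_age_upper_bound t : (exists n, t < T n w)%R ->
  \int[lebesgue_measure]_(s in `[0%R, t]) (age s w)%:E <=
  \sum_(i <oo) cycle_area t (T i w, X i w) +
  \sum_(i <oo) (inherited_age t i * X i w)%:E.
Proof.
move=> Tt.
(* The inherited age is spread over the whole cycle, even beyond [t], which only enlarges the
   bound. *)
pose g i (s : measurableTypeR R) :=
  (inherited_age t i * \1_(`[T i w, T i w + X i w[%classic) s)%R.
have g0 i s : 0 <= (g i s)%:E.
  by rewrite lee_fin mulr_ge0// inherited_age_ge0.
have mi i : measurable_fun setT
    (fun s : measurableTypeR R => (\1_(`[T i w, T i w + X i w[%classic) s)%:E : \bar R).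
  by apply/measurable_EFinP; exact: measurable_indic.
have me i : measurable_fun setT (fun s : measurableTypeR R => (g i s)%:E).
  apply/measurable_EFinP; apply: measurable_funM; first exact: measurable_cst.
  exact: measurable_indic.
have mc i : measurable_fun setT
    (fun s : measurableTypeR R => (cycle_age t (T i w, X i w) s)%:E).
  by apply/measurable_EFinP; exact: measurable_cycle_age.
have gE i : (inherited_age t i * X i w)%:E = \int[lebesgue_measure]_s (g i s)%:E.
  under eq_integral do rewrite EFinM.
  rewrite ge0_integralZl//; last by rewrite lee_fin inherited_age_ge0.
  rewrite integral_indic// setIT [X in _ = _ * X](_ : _ = (X i w)%:E)//.
  apply: (etrans (lebesgue_measure_itv _)).
  by rewrite /= lte_fin ltrDl X_gt0 -EFinD addrAC subrr add0r.
rewrite (eq_eseriesr (fun i _ => gE i)).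
have c0 i s : 0 <= (cycle_age t (T i w, X i w) s)%:E.
  by rewrite lee_fin cycle_age_ge0.
rewrite /cycle_area -!integral_nneseries//.
rewrite -ge0_integralD//; last 4 first.
- by move=> s _; exact: nneseries_ge0.
- exact: ge0_emeasurable_sum.
- by move=> s _; exact: nneseries_ge0.
- exact: ge0_emeasurable_sum.
rewrite [leLHS]integral_mkcond.
apply: (@le_integral_nonmeasurable _ _ _ _ _ set0) => // s _ _.
rewrite patchE; case: ifPn => [/set_mem|_]; last first.
  by rewrite lexx adde_ge0//; exact: nneseries_ge0.
rewrite /= in_itv/= => st; have /andP[s0 st'] := st.
rewrite lee_fin age_ge0//=.
have [i is_] := exists_in_cycle Tt st.
apply: (@le_trans _ _ ((cycle_age t (T i w, X i w) s)%:E + (g i s)%:E)); last first.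
  apply: leeD; first exact: (nneseries_ge_term _ (fun i => c0 i s)).
  exact: (nneseries_ge_term _ (fun i => g0 i s)).
have /and4P[_ _ /= i1 i2] := is_.
rewrite -EFinD lee_fin /cycle_age is_ /g indicE mem_set ?mulr1.
  by apply: age_le_inherited; rewrite i1.
by rewrite /= in_itv/= i1.
Qed.

End sample_path_upper.

(** * Upper bound on the mean age when late packets are rare *)

Section mean_age_upper.
Context (R : realType) (FX FS : probability (measurableTypeR R) R).
Variable q : gginf_queue FX FS.
Local Notation P := (queue_prob q).
Local Notation X := (inter_gen q).
Local Notation T := (start_time q).

(** If all epochs stayed at or below [t] with positive probability, every term of the renewal series
    would be at least that probability and the series would diverge. *)
Lemma ae_start_time_unbounded (t c : R) : renewal_function q t <= c%:E ->
  P (\bigcap_n (T n @^-1` `]-oo, t])) = 0.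
Proof.
move=> rc; set M := \bigcap_n _.
have mM : measurable M.
  by apply: bigcap_measurable => // n _; exact: measurable_funPTI.
have PMf : P M \is a fin_num by exact: fin_num_measure.
apply/eqP; rewrite eq_le measure_ge0 andbT leNgt; apply/negP.
rewrite -(fineK PMf) lte_fin => PM0.
have : (fine (P M) *+ (Num.truncn (c / fine (P M))).+1 <= c)%R.
  rewrite -lee_fin; apply: le_trans rc.
  apply: (@le_trans _ _ (\sum_(0 <= i < (Num.truncn (c / fine (P M))).+1)
      P (T i @^-1` `]-oo, t]))); last exact: nneseries_lim_ge.
  rewrite -[X in (_ *+ X)%R]subn0 -sumr_const_nat -sumEFin; apply: lee_sum => i _.
  rewrite fineK//; apply: le_measure; rewrite ?inE//; first exact: measurable_funPTI.
  by apply: bigcap_inf.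
rewrite -mulr_natr leNgt => /negP; apply.
by rewrite mulrC -ltr_pdivrMr// truncnS_gt.
Qed.

(** The expected area that cycle [j] inherits from cycle [k] is
    [lambda ^- 2 * P(T_k <= t) * p ^+ (j - k)]; the geometric convolution bounds the double sum. *)
Lemma mean_age_upper_bound (lambda t p c : R) : (0 < t)%R ->
  is_inter_gen_dist lambda FX -> FS [set x : R | (0 <= x)%R] = 1 ->
  FS `]0%R, +oo[%classic = p%:E -> (p *+ 2 <= 1)%R ->
  renewal_function q t <= c%:E ->
  \int[P]_w ((t^-1)%:E * \int[lebesgue_measure]_(s in `[0%R, t]) (age s w)%:E) <=
  (t^-1)%:E * (renewal_area q t + (lambda ^- 2 * (p *+ 2 * c))%:E).
Proof.
move=> t0 FXd FS1 FSp p2 rc.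
have p0 : (0 <= p)%R by rewrite -lee_fin -FSp.
have c0 : (0 <= c)%R.
  by rewrite -lee_fin; apply: le_trans rc; exact: nneseries_ge0.
have [N [mN N0 NP]] := ae_positive q FXd.1 FS1.
pose M := \bigcap_n (T n @^-1` `]-oo, t]).
have mM : measurable M.
  by apply: bigcap_measurable => // n _; exact: measurable_funPTI.
have M0 : P M = 0 by exact: ae_start_time_unbounded rc.
(* Absolute values keep [D] nonnegative everywhere, as termwise integration requires, and change
   nothing off the null set [N]. *)
pose D j (w : queue_space q) : \bar R :=
  \sum_(0 <= k < j) (`|X k w| * `|X j w| * \1_(late_run t k (j - k)) w)%:E.
have D0 j w : 0 <= D j w.
  by apply: sume_ge0 => k _; rewrite lee_fin !mulr_ge0.
have mterm j k : measurable_fun setT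
    (fun w => (`|X k w| * `|X j w| * \1_(late_run t k (j - k)) w)%:E).
  apply/measurable_EFinP; apply: measurable_funM.
    by apply: measurable_funM; exact: measurableT_comp.
  by apply: measurable_indic; exact: measurable_late_run.
have mD j : measurable_fun setT (D j) by exact: emeasurable_sum.
have mc i := measurable_queue_cycle_area (q := q) t i.
have ti : 0 <= (t^-1)%:E :> \bar R by rewrite lee_fin invr_ge0 ltW.
pose A w := \sum_(i <oo) cycle_area t (T i w, X i w).
pose B w := \sum_(i <oo) D i w.
have mA : measurable_fun setT A.
  by apply: ge0_emeasurable_sum => // *; exact: cycle_area_ge0.
have mB : measurable_fun setT B by exact: ge0_emeasurable_sum.
have A0 w : 0 <= A w by apply: nneseries_ge0 => *; exact: cycle_area_ge0.
have B0 w : 0 <= B w by exact: nneseries_ge0.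
apply: (@le_trans _ _ (\int[P]_w ((t^-1)%:E * (A w + B w)))).
  apply: (@le_integral_nonmeasurable _ _ _ _ _ (N `|` M)).
  - exact: measurableU.
  - exact: (etrans (measureU0 mN mM M0)).
  move=> w _ /not_orP[/NP[X0 S0] Mw].
  apply/andP; split.
    rewrite mule_ge0//; apply: integral_ge0 => s /=.
    by rewrite in_itv/= => /andP[s0 _]; rewrite lee_fin age_ge0.
  apply: lee_wpmul2l => //.
  have Tt : (exists n, t < T n w)%R.
    apply: contra_notP Mw => /forallNP Tn n _ /=; rewrite in_itv/= leNgt.
    exact/negP.
  apply: le_trans (integral_age_upper_bound X0 S0 Tt) _.
  apply: leeD => //; apply: lee_nneseries => [i _ _|i _].
    by rewrite lee_fin mulr_ge0// ?inherited_age_ge0// ltW.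
  rewrite /D /inherited_age sumEFin lee_fin big_distrl/=; apply: ler_sum => k _.
  by rewrite (ger0_norm (ltW (X0 k))) (ger0_norm (ltW (X0 i))) mulrAC.
rewrite ge0_integralZl//; last 2 first.
- exact: emeasurable_funD.
- by move=> w _; exact: adde_ge0.
apply: lee_wpmul2l => //.
rewrite ge0_integralD//; apply: leeD.
  by rewrite /A integral_nneseries// => *; exact: cycle_area_ge0.
rewrite /B integral_nneseries//.
pose r k := fine (P (T k @^-1` `]-oo, t])).
have rE k : (r k)%:E = P (T k @^-1` `]-oo, t]).
  by rewrite fineK// fin_num_measure//; exact: measurable_funPTI.
have DE j : \int[P]_w D j w =
    (lambda ^- 2 * \sum_(0 <= k < j) r k * p ^+ (j - k))%:E.
  rewrite /D ge0_integral_sum//.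
  rewrite big_distrr/= -sumEFin big_nat_cond [RHS]big_nat_cond.
  apply: eq_bigr => k; rewrite andbT => /andP[_ kj].
  have [n jE] : exists n, j = (k + n.+1)%N.
    by exists (j - k).-1; rewrite prednK ?subn_gt0// subnKC// ltnW.
  rewrite jE addKn.
  transitivity (\int[P]_(w in late_run t k n.+1) (`|X k w| * `|X (k + n.+1)%N w|)%:E).
    rewrite [RHS]integral_mkcond; apply: eq_integral => w _.
    by rewrite patchE indicE; case: ifPn => _; rewrite ?mulr1 ?mulr0.
  rewrite integral_late_run probability_late_run FSp (integral_abs_inter_gen_dist FXd).
  rewrite -rE -EFin_expe -!EFinM; congr EFin.
  by rewrite -invfM -expr2 mulrC.
under eq_eseriesr do rewrite DE.
apply: nneseries_le => [j|n].
  rewrite -DE; apply: integral_ge0 => w _; exact: D0.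
rewrite sumEFin lee_fin -big_distrr/=; apply: ler_wpM2l.
  by rewrite -exprVn sqr_ge0.
apply: geometric_convolution_le => // m.
rewrite -lee_fin -sumEFin; apply: le_trans rc.
under eq_bigr do rewrite rE.
exact: nneseries_lim_ge.
Qed.

End mean_age_upper.

(** * A bounded variance forces a heavy service tail *)

Section service_tail.
Context (R : realType) (FX FS : probability (measurableTypeR R) R).
Variable q : gginf_queue FX FS.
Local Notation P := (queue_prob q).
Local Notation S := (service q).

Lemma delay_varianceE mu : is_service_dist mu FS ->
  delay_variance q = \int[P]_w ((S 0%N w - mu^-1) ^+ 2)%:E.
Proof.
move=> [FS1 FSm].
have dE : (delay 0 : queue_space q -> R) = S 0%N.
  by apply/funext => w; rewrite /delay /recv_time addrAC subrr add0r.
rewrite /delay_variance /variance unlock dE.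
have -> : 'E_P[S 0%N] = (mu^-1)%:E.
  (* The transfer lemma [integral_service] is for nonnegative functions, so the mean passes through
     the absolute value, which is almost surely harmless. *)
  rewrite expectation_def -FSm -(integral_abs_nonneg FS1).
  rewrite -(@integral_service _ _ _ q 0 (fun x => `|x|%:E))//; last first.
    by apply/measurable_EFinP; exact: normr_measurable.
  apply: ae_eq_integral => //.
  - by apply/measurable_EFinP; exact: measurable_funPT.
  - by apply/measurable_EFinP; apply: measurableT_comp => //; exact: measurable_funPT.
  - have m0 : measurable [set x : R | (0 <= x)%R] by rewrite set_ge0E.
    exists (S 0%N @^-1` (~` [set x : R | (0 <= x)%R])); split.
    + by apply: measurable_funPTI; exact: measurableC.
    + transitivity (FS (~` [set x : R | (0 <= x)%R])); last exact: probability_setC0.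
      by apply: service_distE; exact: measurableC.
    + by move=> w /=; apply: contra_not => w0 _; rewrite ger0_norm.
by rewrite unlock; apply: eq_integral => w _.
Qed.

(* Since [S <= m / 2 + K 1_(S > m / 2) + (S - m)^2 / (K - m)] for every [K > m],
   a mean [m] and a variance at most [M] force the tail at [m / 2] to be heavy. *)
Lemma service_tail_lower_bound (mu M : R) : (0 < mu)%R -> (0 < M)%R ->
  is_service_dist mu FS -> delay_variance q <= M%:E ->
  ((mu^-1 / (4 * (mu^-1 + 4 * M * mu)))%:E <= FS `](mu^-1 / 2)%R, +oo[%classic).
Proof.
move=> mu0 M0 FSd; rewrite (delay_varianceE FSd) => VM.
(* [K] makes [(K - m)^-1 * M] equal to [m / 4]; the inequality between means then leaves
   [m / 4 <= K * c] for the tail probability [c]. *)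
set m := (mu^-1)%R in VM *; set K := (m + 4 * M * mu)%R.
have m0 : (0 < m)%R by rewrite invr_gt0.
have Km : (0 < K - m)%R by rewrite /K addrAC subrr add0r !mulr_gt0.
have K0 : (0 < K)%R by lra.
pose E := S 0%N @^-1` `](m / 2)%R, +oo[.
have mE : measurable E by exact: measurable_funPTI.
have mS2 : measurable_fun setT (fun w => ((S 0%N w - m) ^+ 2)%:E).
  apply/measurable_EFinP; apply: measurable_funX; apply: measurable_funB => //.
have mean : m%:E = \int[P]_w `|S 0%N w|%:E.
  rewrite (@integral_service _ _ _ q 0 (fun x => `|x|%:E))//; last first.
    by apply/measurable_EFinP; exact: normr_measurable.
  by rewrite (integral_abs_nonneg FSd.1) FSd.2.
have bound : m%:E <= (m / 2)%:E + K%:E * P E +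
    ((K - m)^-1)%:E * \int[P]_w ((S 0%N w - m) ^+ 2)%:E.
  have -> : (m / 2)%:E = \int[P]_w (m / 2)%:E.
    by rewrite -[LHS]mule1 -(probability_setT P) -integral_cst.
  rewrite -[X in _ * P X]setIT -integral_indic//.
  rewrite -ge0_integralZl//; last 2 first.
  - by apply/measurable_EFinP; exact: measurable_indic.
  - by rewrite lee_fin ltW.
  rewrite -ge0_integralZl//; last 2 first.
  - by move=> w _; rewrite lee_fin sqr_ge0.
  - by rewrite lee_fin invr_ge0 ltW.
  have mKE : measurable_fun setT (fun w => K%:E * (\1_E w)%:E).
    by apply: emeasurable_funM => //; apply/measurable_EFinP; exact: measurable_indic.
  have KE0 w : 0 <= K%:E * (\1_E w)%:E by rewrite mule_ge0// lee_fin ltW.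
  have mKS : measurable_fun setT (fun w => ((K - m)^-1)%:E * ((S 0%N w - m) ^+ 2)%:E).
    exact: emeasurable_funM.
  rewrite -ge0_integralD//; last by move=> w _; rewrite lee_fin divr_ge0// ltW.
  rewrite -ge0_integralD//; last 3 first.
  - by move=> w _; rewrite adde_ge0// lee_fin divr_ge0// ltW.
  - exact: emeasurable_funD.
  - by move=> w _; rewrite mule_ge0// lee_fin ?sqr_ge0// invr_ge0 ltW.
  pose N := S 0%N @^-1` (~` `[0%R, +oo[).
  rewrite mean; apply: (@le_integral_nonmeasurable _ _ _ _ _ N).
  - by apply: measurable_funPTI; exact: measurableC.
  - transitivity (FS (~` `[0%R, +oo[%classic)).
      by apply: service_distE; exact: measurableC.
    by apply: probability_setC0 => //; rewrite -set_ge0E; exact: FSd.1.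
  move=> w _; rewrite /N /= in_itv/= andbT => /contrapT x0.
  rewrite -!EFinM -!EFinD !lee_fin normr_ge0/= ger0_norm//.
  set x := S 0%N w in x0 *.
  have sq0 : (0 <= (K - m)^-1 * (x - m) ^+ 2)%R.
    by rewrite mulr_ge0 ?sqr_ge0// invr_ge0 ltW.
  have [xm|xm] := leP x (m / 2)%R.
    have : (0 <= K * \1_E w)%R by rewrite mulr_ge0// ltW.
    by lra.
  rewrite indicE mem_set ?mulr1; last by rewrite /E /= in_itv/= andbT.
  have [xK|xK] := leP x K; first by lra.
  (* Beyond [K] the factor [(x - m) / (K - m)] is at least one. *)
  have : (x - m <= (K - m)^-1 * (x - m) ^+ 2)%R.
    have mx : (0 <= x - m)%R.
      by rewrite subr_ge0; apply/ltW/(lt_trans _ xK); rewrite -subr_gt0.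
    by rewrite ler_pdivlMl// expr2 ler_wpM2r// lerB// ltW.
  by move: ((K - m)^-1 * _)%R => y; lra.
have PE : P E = FS `](m / 2)%R, +oo[%classic by exact: service_distE.
rewrite -PE; have /fineK PEf : P E \is a fin_num by exact: fin_num_measure.
rewrite -PEf lee_fin; move: bound; rewrite -PEf.
set c := fine (P E).
have V0 : 0 <= \int[P]_w ((S 0%N w - m) ^+ 2)%:E.
  by apply: integral_ge0 => w _; rewrite lee_fin sqr_ge0.
move=> /le_trans/(_ (leeD (lexx _) (lee_wpmul2l _ VM))).
have Ki : 0 <= ((K - m)^-1)%:E :> \bar R by rewrite lee_fin invr_ge0 ltW.
move=> /(_ Ki); rewrite -!EFinM -!EFinD lee_fin => bound.
have KmM : ((K - m)^-1 * M = m / 4)%R.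
  rewrite /K addrAC subrr add0r /m; field.
  by rewrite !gt_eqF.
rewrite KmM in bound.
rewrite -/m -/K ler_pdivrMr ?mulr_gt0//.
by rewrite (_ : c * (4 * K) = 4 * (K * c))%R; [lra|ring].
Qed.

End service_tail.

(** * Auxiliary constants and the test distributions *)

Lemma exists_positive_mass (R : realType) (F : probability (measurableTypeR R) R)
    (s : R) : (0 < s)%R -> F [set x : R | (0 < x)%R] = 1 ->
  exists a b : R, [/\ (0 < a)%R, (a <= s)%R,
    (0 < fine (F `[a, b]%classic))%R & (0 < fine (F `[a, +oo[%classic))%R].
Proof.
move=> s0 F1; suff [a [b [a0 as_ Fab]]] : exists a b : R,
    [/\ (0 < a)%R, (a <= s)%R & 0 < F `[a, b]%classic].
  exists a, b; split=> //; rewrite fine_gt0// ltey_eq fin_num_measure// andbT//.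
  apply: (lt_le_trans Fab); apply: le_measure; rewrite ?inE//.
  by move=> x /=; rewrite !in_itv/= andbT => /andP[].
apply: contrapT => noab.
(* These intervals cover the positive half-line, so they cannot all be null; the minimum keeps the
   left end at most [s]. *)
pose I n : set R := `[(Num.min n.+1%:R^-1 s)%R, (n%:R)%R]%classic.
have F0 n : F (I n) = 0.
  apply/eqP; rewrite eq_le measure_ge0 andbT leNgt; apply/negP => Fn.
  apply: noab; exists (Num.min n.+1%:R^-1 s)%R, (n%:R)%R; split => //.
    by rewrite lt_min s0 invr_gt0 ltr0n.
  by rewrite ge_min lexx orbT.
pose A := \bigcup_n (I n : set (measurableTypeR R)).
have mI n : measurable (I n : set (measurableTypeR R)) by exact: measurable_itv.
have mA : measurable A by apply: bigcup_measurable.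
have FA : F A = 0.
  apply: measure_negligible => //; apply: negligible_bigcup => n.
  by exists (I n); split=> //; exact: F0.
have : F [set x : R | (0 < x)%R] <= F A.
  apply: le_measure; rewrite ?inE//.
    by rewrite set_gt0E.
  move=> x /= x0; pose n := maxn (Num.truncn x).+1 (Num.truncn x^-1).
  exists n => //; rewrite /I /= in_itv/= ge_min; apply/andP; split.
    apply/orP; left; rewrite invf_ple ?posrE//; apply/ltW.
    by apply: (lt_le_trans (truncnS_gt _)); rewrite ler_nat ltnS leq_max leqnn orbT.
  by apply/ltW/(lt_le_trans (truncnS_gt _)); rewrite ler_nat leq_max leqnn.
by rewrite F1 FA lee_fin ler10.
Qed.

(* Services are instantaneous, except with probability [p], when they last long
   enough to restore the mean. *)
Lemma exists_rarely_late_service (R : realType) (mu p : R) : (0 < mu)%R ->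
  (0 < p)%R -> (p <= 1)%R ->
  exists2 F : probability (measurableTypeR R) R,
    is_service_dist mu F & F `]0%R, +oo[%classic = p%:E.
Proof.
(* [L] is the value for which [p * L] is the required mean [mu^-1]. *)
move=> mu0 p0 p1; pose L := ((mu * p)^-1)%R.
have L0 : (0 < L)%R by rewrite invr_gt0 mulr_gt0.
have p01 : (0 <= p <= 1)%R by rewrite ltW.
pose f (b : bool) : measurableTypeR R := if b then L else 0%R.
have mf : measurable_fun setT f by [].
pose fm : {mfun bool >-> measurableTypeR R} := mfun_Sub (mem_set mf).
pose F : probability (measurableTypeR R) R := distribution (bernoulli_prob p) fm.
have FE (A : set R) : F A =
    p%:E * \d_true (f @^-1` A) + (1 - p)%:E * \d_false (f @^-1` A).
  exact: bernoulli_probE.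
have F1 : F [set x : R | (0 <= x)%R] = 1.
  rewrite FE !diracE !mem_set/=; [|exact: lexx|exact: ltW].
  by rewrite !mule1 -EFinD; congr EFin; lra.
exists F; last first.
  rewrite FE !diracE mem_set/=; last by rewrite in_itv/= L0.
  by rewrite memNset/= ?in_itv/= ?ltxx// mule1 mule0 adde0.
split => //; rewrite -(integral_abs_nonneg F1).
rewrite (ge0_integral_distribution fm (f := fun x => `|x|%:E))//; last first.
  by apply/measurable_EFinP; exact: normr_measurable.
rewrite integral_bernoulli_prob//; last by move=> b /=; rewrite lee_fin.
transitivity (p%:E * `|L|%:E + (1 - p)%:E * `|0%R : R|%:E) => //.
rewrite normr0 mule0 adde0 -EFinM (ger0_norm (ltW L0)).
by rewrite /L invfM; congr EFin; field; rewrite !gt_eqF.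
Qed.

Lemma limf_esup_le_near (R : realType) (f g : R -> \bar R) (e t0 : R) :
  (forall t, (t0 < t)%R -> g t + e%:E <= f t) ->
  limf_esup g (pinfty_nbhs R) + e%:E <= limf_esup f (pinfty_nbhs R).
Proof.
move=> gf; apply: le_ereal_inf_tmp => _ [V FV <-].
have FV' : pinfty_nbhs R (V `&` [set t | (t0 < t)%R]).
  by apply: filterI => //; exists t0; split => //; rewrite num_real.
apply: (@le_trans _ _ (ereal_sup (g @` (V `&` [set t | (t0 < t)%R])) + e%:E)).
  by apply: leeD2r; apply: ereal_inf_lbound; exists (V `&` [set t | (t0 < t)%R]).
rewrite -leeBrDr//; apply: ge_ereal_sup => _ [t [Vt /= tt0] <-].
rewrite EFinN leeBrDr//; apply: le_trans (gf t tt0) _.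
by apply: ereal_sup_ubound; exists t.
Qed.

(** * The gap in average age and the divergence of the variance *)

Section tradeoff.
Context (R : realType) (lambda mu : R) (FX : probability (measurableTypeR R) R).
Variable Q : forall FS : probability (measurableTypeR R) R, gginf_queue FX FS.
Hypothesis lambda_gt0 : (0 < lambda)%R.
Hypothesis mu_gt0 : (0 < mu)%R.
Hypothesis FX_dist : is_inter_gen_dist lambda FX.

(* The average age of the queue in which all services are instantaneous. *)
Definition renewal_average_age : \bar R :=
  limf_esup (fun t : R => `|t^-1|%:E * renewal_area (Q FX) t) (pinfty_nbhs R).

(** The absolute value in [renewal_average_age] keeps the function nonnegative at negative [t]
    too. *)
Lemma renewal_average_age_ge0 : 0 <= renewal_average_age.
Proof.
apply: limf_esup_ge0; first exact: filter_not_empty.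
by move=> t; rewrite mule_ge0 ?lee_fin// renewal_area_ge0.
Qed.

Lemma renewal_average_age_le FS : is_service_dist mu FS ->
  renewal_average_age <= average_age (Q FS).
Proof.
move=> [FS1 _]; rewrite -[leLHS]adde0.
apply: (limf_esup_le_near (t0 := 0%R)) => t t0; rewrite adde0.
(* The constants are [a = b = s0 = 1]; any others would do, as the extra term only has to be
   nonnegative. *)
apply: le_trans
  (mean_age_lower_bound (Q FS) 1%R t0 ltr01 (lexx 1%R) FX_dist.1 FS1).
rewrite ger0_norm ?invr_ge0 ?(ltW t0)//; apply: lee_wpmul2l.
  by rewrite lee_fin invr_ge0 ltW.
rewrite (eq_renewal_area (Q FX) (Q FS)) leeDl// mule_ge0//.
  by rewrite mule_ge0 ?lee_fin ?sqr_ge0// !mule_ge0.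
exact: nneseries_ge0.
Qed.

(** The level [M] guarantees a tail mass [c] beyond [s = 1 / (2 mu)], so each renewal carries an
    expected extra area of at least [k], uniformly in [FS], and renewals occur at a positive
    rate. *)
Lemma average_age_gap (M : R) : (0 < M)%R -> exists2 e : R, (0 < e)%R &
  forall FS, is_service_dist mu FS -> delay_variance (Q FS) <= M%:E ->
    renewal_average_age + e%:E <= average_age (Q FS).
Proof.
move=> M0; pose s := (mu^-1 / 2)%R.
have s0 : (0 < s)%R by rewrite divr_gt0// invr_gt0.
have [a [b [a0 as_ pab0 pa0]]] := exists_positive_mass s0 FX_dist.1.
pose c := (mu^-1 / (4 * (mu^-1 + 4 * M * mu)))%R.
have mi0 : (0 < mu^-1)%R by rewrite invr_gt0.
have c0 : (0 < c)%R.
  by rewrite divr_gt0// mulr_gt0// addr_gt0// !mulr_gt0.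
have fab : FX `[a, b]%classic \is a fin_num by exact: fin_num_measure.
have fa : FX `[a, +oo[%classic \is a fin_num by exact: fin_num_measure.
move: pab0 pa0; set pab := fine _; set pa := fine _ => pab0 pa0.
pose k := (a ^+ 2 * (pab * (pa * c)))%R.
have k0 : (0 < k)%R.
  by apply: mulr_gt0; [exact: exprn_gt0|do 2! apply: mulr_gt0 => //].
(* From time [2 (b + s)] on, [t - b - s >= t / 2], so the expected number of renewals up to
   [t - b - s] is at least [lambda t / 8]. *)
exists (k * lambda / 8)%R; first by rewrite divr_gt0// mulr_gt0.
move=> FS FSd VM; apply: (limf_esup_le_near (t0 := Num.max 0 (2 * (b + s)))%R).
move=> t; rewrite gt_max => /andP[t0 tbs].
apply: le_trans (mean_age_lower_bound (Q FS) b t0 a0 as_ FX_dist.1 FSd.1).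
rewrite ger0_norm ?invr_ge0 ?(ltW t0)// (eq_renewal_area (Q FX) (Q FS)).
have ti : (0 <= t^-1)%R by rewrite invr_ge0 ltW.
rewrite [leRHS]ge0_muleDr//; last 2 first.
- exact: renewal_area_ge0.
- rewrite mule_ge0//; last exact: nneseries_ge0.
  by rewrite mule_ge0 ?lee_fin ?sqr_ge0// !mule_ge0.
apply: leeD2l.
have tbs' : (0 < t - b - s)%R by lra.
have := renewal_function_lower (Q FS) tbs' lambda_gt0 FX_dist.
have := service_tail_lower_bound mu_gt0 M0 FSd VM.
rewrite -/c -/s => cS lR.
apply: (@le_trans _ _ ((t^-1)%:E * (k%:E * (lambda * (t - b - s) / 4)%:E))).
  rewrite -!EFinM lee_fin ler_pdivlMl//.
  have : (k * lambda * t <= k * lambda * (2 * (t - b - s)))%R.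
    by rewrite ler_wpM2l//; [rewrite mulr_ge0// ltW|lra].
  lra.
apply: lee_wpmul2l; first by rewrite lee_fin.
apply: lee_pmul => //; first by rewrite lee_fin ltW.
  by rewrite lee_fin divr_ge0// mulr_ge0// ltW.
rewrite /k !EFinM !fineK//.
apply: lee_wpmul2l; first by rewrite lee_fin sqr_ge0.
by do 2! (apply: lee_wpmul2l => //).
Qed.

(** The test distribution with late probability [p] has an average age at most [C * p] above the
    renewal one, and [p] can be taken arbitrarily small. *)
Lemma min_age_le : min_age mu Q <= renewal_average_age.
Proof.
apply/lee_addgt0Pr => e e0.
have [a [_ [a0 _ _]]] := exists_positive_mass ltr01 FX_dist.1.
have fa : FX `[a, +oo[%classic \is a fin_num by exact: fin_num_measure.
set pa := fine (FX `[a, +oo[%classic) => pa0.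
(* For [t > a] the renewal bound [(t + a) / (a * pa)] is at most [2 t / (a * pa)]; multiplied by
   [lambda ^- 2 * 2 p / t], this is [C * p]. *)
pose C := (lambda ^- 2 * 4 / (a * pa))%R.
have C0 : (0 < C)%R by rewrite divr_gt0// mulr_gt0// invr_gt0 exprn_gt0.
have [p [p0 p12 pC]] : exists p : R, [/\ 0 < p, p <= 2^-1 & C * p <= e]%R.
  exists (Num.min (2^-1) (e / C))%R; split.
  - by rewrite lt_min invr_gt0 ltr0n divr_gt0.
  - by rewrite ge_min lexx.
  - by rewrite mulrC -ler_pdivlMr// ge_min lexx orbT.
have p2 : (p *+ 2 <= 1)%R by rewrite mulr2n; lra.
have p1 : (p <= 1)%R by lra.
have [FS FSd FSp] := exists_rarely_late_service mu_gt0 p0 p1.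
apply: (@le_trans _ _ (average_age (Q FS))).
  by apply: ereal_inf_lbound; exists FS.
rewrite -leeBlDr// -EFinN; apply: (limf_esup_le_near (t0 := a)) => t at_.
have t0 : (0 < t)%R by exact: lt_trans at_.
rewrite EFinN leeBlDr//.
have apa0 : (0 < a * pa)%R by rewrite mulr_gt0.
have rt : renewal_function (Q FS) t <= ((t + a) / (a * pa))%:E.
  have := renewal_function_upper (Q FS) (ltW t0) a0 FX_dist.1 FSd.1.
  rewrite -[X in _ * X * _]fineK// -EFinM -/pa.
  have rge0 : 0 <= renewal_function (Q FS) t by exact: nneseries_ge0.
  by move=> H; rewrite (EFinM (t + a)%R) lee_pdivlMr// muleC.
apply: le_trans (mean_age_upper_bound t0 FX_dist FSd.1 FSp p2 rt) _.
have ti : (0 <= t^-1)%R by rewrite invr_ge0 ltW.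
rewrite ge0_muleDr//; last 2 first.
- exact: renewal_area_ge0.
- rewrite lee_fin mulr_ge0 ?invr_ge0 ?sqr_ge0// mulr_ge0//.
    by rewrite mulrn_wge0// ltW.
  by rewrite divr_ge0 ?(ltW apa0)// addr_ge0 ?ltW.
rewrite ger0_norm// (eq_renewal_area (Q FX) (Q FS)); apply: leeD2l.
rewrite -EFinM lee_fin; apply: le_trans pC.
rewrite ler_pdivrMl//.
have -> : (lambda ^- 2 * (p *+ 2 * ((t + a) / (a * pa))) = C * p * (t + a) / 2)%R.
  by rewrite /C -mulr_natr; field; rewrite !gt_eqF.
have : (C * p * (t + a) <= C * p * (t + t))%R.
  by rewrite ler_wpM2l//; [rewrite mulr_ge0// ltW|rewrite lerD2l ltW].
lra.
Qed.

(** Let [e] be the gap for the level [max M 1], a positive level above [M]. As [min_age] is at most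
    the renewal average age, an average age below [min_age + e] excludes every variance under
    [M]. *)
Lemma min_delay_variance_cvgy :
  min_delay_variance mu Q a @[a --> (min_age mu Q)^'] --> +oo.
Proof.
apply/cvgeyPge => M.
have M0 : (0 < Num.max M 1)%R by rewrite lt_max ltr01 orbT.
have [e e0 gap] := average_age_gap M0.
have V_ge a : (forall FS, is_service_dist mu FS -> average_age (Q FS) <= a ->
    ~ renewal_average_age + e%:E <= average_age (Q FS)) ->
    M%:E <= min_delay_variance mu Q a.
  move=> no; apply: le_ereal_inf_tmp => _ [FS [FSa FSd] <-].
  rewrite leNgt; apply/negP => VM; apply: (no FS) => //; apply: gap => //.
  by apply: (le_trans (ltW VM)); rewrite lee_fin le_max lexx.
have := min_age_le; case E : (min_age mu Q) => [r| |] rA.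
- near=> a; apply: V_ge => FS FSd FSa gapFS.
  have : a < r%:E + e%:E.
    near: a; apply: nbhs_dnbhs; apply: open_ereal_lt'.
    by rewrite -EFinD lte_fin ltrDl.
  rewrite ltNge => /negP; apply; apply: le_trans FSa; apply: le_trans gapFS.
  exact: leeD2r.
(* If [min_age] is [+oo], so is every average age. The punctured neighbourhood gives [a != +oo], so
   the infimum is over the empty set. *)
- near=> a; apply: V_ge => FS FSd FSa _.
  have : a != +oo by near: a; exact: nbhs_dnbhs_neq.
  rewrite -leye_eq => /negP; apply; apply: (le_trans _ FSa).
  exact: le_trans rA (renewal_average_age_le FSd).
(* All average ages are at least the nonnegative renewal average age, which excludes [-oo]. *)
- have : 0 <= min_age mu Q.
    apply: le_ereal_inf_tmp => _ [FS FSd <-].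
    exact: le_trans renewal_average_age_ge0 (renewal_average_age_le FSd).
  by rewrite E.
Unshelve. all: by end_near. Qed.

End tradeoff.

Theorem theorem7 (R : realType) (lambda mu : R)
    (FX : probability (measurableTypeR R) R)
    (Q : forall FS : probability (measurableTypeR R) R, gginf_queue FX FS)
    (lambda_gt0 : (0 < lambda)%R) (lambda_lt_mu : (lambda < mu)%R)
    (FX_dist : is_inter_gen_dist lambda FX) :
  min_delay_variance mu Q a @[a --> (min_age mu Q)^'] --> +oo.
Proof.
exact: (min_delay_variance_cvgy Q lambda_gt0 (lt_trans lambda_gt0 lambda_lt_mu)
  FX_dist).
Qed.
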